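(* Let $C\{r_j\}$ be a central Cantor set whose gap sequence is doubling. Then for any $s\in[\dim_A C\{r_j\},1]$ there is a complementary set $E$ of the gap sequence of $C\{r_j\}$ such that $\dim_A E=s$.
   Context: Given ratios $\{r_j\}_{j\ge1}$ with $0<r_j<1/2$, the central Cantor set $C\{r_j\}$ is constructed in the same fashion as the classical Cantor set starting from $[0,1]$ (at each step removing from each interval a centred open interval), with the $2^k$ closed intervals of step $k$ each having length $r_1\cdots r_k$. Its gap sequence is $a=\{a_i\}_{i\ge 1}$, where $a_1=1-2r_1$ and $a_i=r_1\cdots r_n(1-2r_{n+1})$ if $2^n\le i\le 2^{n+1}-1$, $n\ge 1$. A sequence $\{a_n\}$ is called doubling if it is decreasing ($a_n\ge a_{n+1}$ for all $n$) and there is a constant $\tau$ such that $a_n\le\tau a_{2n}$ for all $n$. For a positive summable sequence $a$ with sum $L$, the complementary sets of $a$ are the closed subsets $E$ of $[0,L]$ of the form $E=[0,L]\setminus\bigcup_{j=1}^\infty U_j$, where $\{U_j\}$ is a disjoint family of open intervals contained in $[0,L]$ with the length of $U_j$ equal to $a_j$ for each $j$. For non-empty $F\subset\mathbb{R}$, $N_r(F)$ denotes the minimum number of closed balls of radius $r$ needed to cover $F$, and $B(x,R)$ is the closed ball of radius $R$ centred at $x$. The Assouad dimension is $$\dim_A F=\inf\Bigl\{\alpha:\ \exists\, c,\rho>0 \text{ such that } \sup_{x\in F}N_r(B(x,R)\cap F)\le c\left(\tfrac{R}{r}\right)^{\alpha}\text{ for all }0<r<R<\rho\Bigr\}.$$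 *)

(* Defs.v *)
From mathcomp Require Import all_boot all_order all_algebra.
From mathcomp Require Import all_classical all_reals all_analysis.

Set Implicit Arguments.
Unset Strict Implicit.
Unset Printing Implicit Defensive.

Import Order.TTheory GRing.Theory Num.Theory.
Import numFieldNormedType.Exports.

Local Open Scope classical_set_scope.
Local Open Scope ring_scope.

(* Ratio sequences r and gap sequences a are indexed from 1: the values r 0   *)
(* and a 0 are never used.                                                    *)

(* (p, q) stands for the closed interval [p, q]; step k+1 replaces it by the  *)
(* two closed intervals of length r_{k+1} (q - p) that remain after removing  *)
(* the centred open interval.                                                 *)
Fixpoint cantor_step (R : realType) (r : nat -> R) (k : nat) : seq (R * R) :=
  if k is k'.+1 then
    flatten [seq [:: (J.1, J.1 + r k * (J.2 - J.1));
                     (J.2 - r k * (J.2 - J.1), J.2)] | J <- cantor_step r k']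
  else [:: (0, 1)].

Definition central_cantor (R : realType) (r : nat -> R) : set R :=
  \bigcap_k [set x | exists2 J, J \in cantor_step r k & J.1 <= x <= J.2].

(* For 1 <= i, trunc_log 2 i is the n such that 2^n <= i <= 2^(n+1) - 1.      *)
Definition gap_seq (R : realType) (r : nat -> R) (i : nat) : R :=
  let n := trunc_log 2 i in
  (\prod_(1 <= j < n.+1) r j) * (1 - 2 * r n.+1).

Definition doubling (R : realType) (a : nat -> R) : Prop :=
  (forall n, (1 <= n)%N -> a n.+1 <= a n) /\
  (exists tau : R, forall n, (1 <= n)%N -> a n <= tau * a (2 * n)%N).

Definition complementary_set (R : realType) (a : nat -> R) (E : set R) : Prop :=
  exists L : R, (\sum_(1 <= i < n.+1) a i) @[n --> \oo] --> L /\
  exists u v : nat -> R,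
    [/\ forall j, (1 <= j)%N ->
          v j - u j = a j /\ `]u j, v j[%classic `<=` `[0, L]%classic,
        trivIset [set j | (1 <= j)%N] (fun j => `]u j, v j[%classic),
        E = `[0, L]%classic `\` \bigcup_(j in [set j | (1 <= j)%N]) `]u j, v j[%classic
      & closed E].

(* The infimum is over natural numbers, hence attained; it is +oo when no     *)
(* finite cover exists.                                                       *)
Definition covering_number (R : realType) (e : R) (F : set R) : \bar R :=
  ereal_inf [set (n%:R)%:E | n in
    [set n | exists c : nat -> R, F `<=` \bigcup_(i < n) closed_ball (c i) e]].

Definition assouad_dim (R : realType) (F : set R) : \bar R :=
  ereal_inf [set alpha%:E | alpha in
    [set alpha : R | exists c rho : R, [/\ 0 < c, 0 < rho &
       forall e d : R, 0 < e -> e < d -> d < rho ->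
         (ereal_sup [set covering_number e (closed_ball x d `&` F) | x in F]
            <= (c * (d / e) `^ alpha)%:E)%E]]].

(* Main.v *)
Require Import Defs.
From mathcomp Require Import all_boot all_order all_algebra.
From mathcomp Require Import all_classical all_reals all_analysis.
From mathcomp Require Import lra ring zify.

Set Implicit Arguments.
Unset Strict Implicit.
Unset Printing Implicit Defensive.

Import Order.TTheory GRing.Theory Num.Theory.
Import numFieldNormedType.Exports.

Local Open Scope classical_set_scope.
Local Open Scope ring_scope.

(** A complementary set is determined by the order of its gaps: given a strict total order on
    the indices, the gap j is put at distance the sum of the gaps preceding it, and the
    complement of the gaps carries no length of its own (arrangement_sum_left). The theorem is
    thus about the orders of the gaps, of which there are 2^n of size A n for each n.

    The gaps are placed at the nodes of the infinite binary tree and read in symmetric order.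
    Suppose that gaps decay geometrically along the branches, by a factor of order 2^(-k/alpha)
    after k levels, with alpha < 1. A convex set of gaps has a topmost one (convex_top), a
    subtree has a total length of the order of its topmost gap (subtree_total_le), and a
    subtree of topmost gap d contains at most of the order of (d/e)^alpha gaps of size at
    least e (subtree_large_count). So the set has Assouad dimension at most alpha
    (tree_assouad_dim_le). Conversely 2^k points at mutual distances of order e in an interval
    of length of order e 2^(k/s), for k arbitrarily large, make the dimension at least s
    (assouad_dim_ge).

    If s < 1, then for each alpha in ]s, 1[ the gaps of the Cantor set satisfy
    A (n + m) <= D A n 2^(-m/alpha), because its covering numbers count its intervals, whose
    lengths are comparable to the gaps (level_gap_decay). Doubling forces s > 0. The tree is
    made of two parts. The right subtree of the root is a copy of the usual tree of the Cantor
    set, each node of which receives two gaps or only one, so that up to half of the gaps can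
    be taken away. The gaps taken away fill a comb: along the leftmost branch hang finite full
    binary trees, deeper and deeper, in each of which the sizes decay like
    2^(-k/s) after k levels, up to the doubling constant. Such a slow decay needs more gaps of each
    size than the tree of the Cantor set offers at that depth, but for a finite tree
    enough of them are available at high levels. The gaps of the whole tree decay with
    exponent alpha for each alpha > s close to s (placement_decay), and the finite trees make
    the dimension at least s (intermediate_dim_ge). Since only the exponents alpha > s are
    used, s may be the dimension of the Cantor set itself.

    If s = 1, the gaps are put in their natural order: the gaps of one level give arithmetic
    progressions of unbounded length (natural_order_dim_ge1), and no subset of the line has a
    larger dimension (assouad_dim_le1). *)

(** * Sums over sets of indices *)

Section Sums.
Variables (R : realType) (b : nat -> R).
Hypothesis b_gt0 : forall i, 0 < b i.
Hypothesis b_cvg : cvgn (fun n => \sum_(i < n) b i).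

Definition sum_over (P : pred nat) : R := limn (fun n => \sum_(i < n | P i) b i).

Lemma partial_sum_homo (P : pred nat) :
  {homo (fun n => \sum_(i < n | P i) b i) : n m / (n <= m)%N >-> n <= m}.
Proof.
apply: homo_leq => [x|y x z|n]; [exact: lexx|exact: le_trans|].
rewrite big_mkcond [leRHS]big_mkcond big_ord_recr /= lerDl.
by case: ifP => // _; exact: ltW.
Qed.

Lemma sum_over_cvg (P : pred nat) :
  (fun n => \sum_(i < n | P i) b i) @ \oo --> sum_over P.
Proof.
apply: nondecreasing_is_cvgn; first exact: partial_sum_homo.
exists (limn (fun n => \sum_(i < n) b i)) => _ [n _ <-].
apply: (le_trans (y := \sum_(i < n) b i)); last first.
  apply: nondecreasing_cvgn_le => //; exact: (@partial_sum_homo xpredT).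
rewrite big_mkcond ler_sum// => i _; case: ifP => // _; exact: ltW.
Qed.

Lemma partial_sum_le (P : pred nat) n : \sum_(i < n | P i) b i <= sum_over P.
Proof.
apply: (nondecreasing_cvgn_le (u_ := fun n => \sum_(i < n | P i) b i)).
  exact: partial_sum_homo.
exact: sum_over_cvg.
Qed.

Lemma sum_over_le (P : pred nat) (c : R) :
  (forall n, \sum_(i < n | P i) b i <= c) -> sum_over P <= c.
Proof.
move=> h; apply: limr_le; first exact: sum_over_cvg.
by apply: nearW => n; exact: h.
Qed.

Lemma sum_over_sub (P Q : pred nat) :
  (forall i, P i -> Q i) -> sum_over P <= sum_over Q.
Proof.
move=> PQ; apply: sum_over_le => n; apply: le_trans (partial_sum_le Q n).
rewrite big_mkcond [leRHS]big_mkcond ler_sum// => i _.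
case: ifP => [/PQ -> //|_]; case: ifP => // _; exact: ltW.
Qed.

Lemma sum_overD (P Q S : pred nat) :
  (forall i, S i = P i || Q i) -> (forall i, P i -> Q i -> False) ->
  sum_over S = sum_over P + sum_over Q.
Proof.
move=> SPQ PQ.
apply: cvg_lim => //.
have -> : (fun n => \sum_(i < n | S i) b i) =
          (fun n => \sum_(i < n | P i) b i + \sum_(i < n | Q i) b i).
  apply/funext => n; rewrite big_mkcond [X in _ = X + _]big_mkcond [X in _ = _ + X]big_mkcond.
  rewrite -big_split /=.
  apply: eq_bigr => i _; rewrite SPQ.
  case Pi: (P i); case Qi : (Q i) => /=; rewrite ?addr0 ?add0r//.
  by case: (PQ i).
apply: cvgD; exact: sum_over_cvg.
Qed.

Lemma sum_over1 j : sum_over (pred1 j) = b j.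
Proof.
apply/eqP; rewrite eq_le; apply/andP; split.
  apply: sum_over_le => n; rewrite big_mkcond /=.
  case: (ltnP j n) => jn.
    rewrite (bigD1 (Ordinal jn)) //= eqxx big1 ?addr0 // => i.
    by rewrite -val_eqE /= => /negbTE ->.
  rewrite big1 ?ltW // => i _; case: eqP => // e.
  by have := ltn_ord i; rewrite e ltnNge jn.
apply: le_trans (partial_sum_le _ j.+1).
rewrite big_mkcond /= (bigD1 ord_max)//= eqxx lerDl.
by apply: sumr_ge0 => i _; case: ifP => // _; exact: ltW.
Qed.

Lemma sum_over_ge0 (P : pred nat) : 0 <= sum_over P.
Proof.
by apply: le_trans (partial_sum_le P 0); rewrite big_ord0.
Qed.

End Sums.

(** * Closed sets with prescribed gaps in a prescribed order *)

Section Arrangement.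
Variables (R : realType) (b : nat -> R) (prec : rel nat).
Hypothesis b_gt0 : forall i, 0 < b i.
Hypothesis b_cvg : cvgn (fun n => \sum_(i < n) b i).
Hypothesis precxx : forall i, prec i i = false.
Hypothesis prec_trans : transitive prec.
Hypothesis prec_total : forall i j, i != j -> prec i j || prec j i.

(** The gaps are packed in the order prec without any other length in between: the left end
    of a gap is the sum of the gaps that precede it. *)
Definition gap_left (j : nat) : R := sum_over b (fun i => prec i j).
Definition gap_right (j : nat) : R := gap_left j + b j.
Definition total_length : R := sum_over b xpredT.

Definition arrangement : set R :=
  [set y | 0 <= y <= total_length /\ forall j, ~ (gap_left j < y < gap_right j)].

Lemma gap_left_lt_right j : gap_left j < gap_right j.
Proof. by rewrite ltrDl. Qed.

Lemma prec_asym i j : prec i j -> prec j i = false.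
Proof. by move=> ij; apply/negP => /(prec_trans ij); rewrite precxx. Qed.

Lemma nprecP i j : ~~ prec j i = prec i j || (i == j).
Proof.
have [->|ne] := eqVneq i j; first by rewrite precxx.
rewrite orbF; case: (boolP (prec i j)) => [/prec_asym ->//|].
by have := prec_total ne; case: (prec i j) => //= ->.
Qed.

Lemma gap_right_sum j : gap_right j = sum_over b (fun i => ~~ prec j i).
Proof.
rewrite /gap_right -(sum_over1 b_gt0 b_cvg j); apply/esym.
apply: (@sum_overD _ _ b_gt0 b_cvg) => [i|i]; first exact: nprecP.
by move=> ij /eqP e; rewrite e precxx in ij.
Qed.

Lemma gap_right_le_left j k : prec j k -> gap_right j <= gap_left k.
Proof.
move=> jk; rewrite gap_right_sum; apply: sum_over_sub => // i.
by rewrite nprecP => /orP[ij|/eqP ->//]; exact: prec_trans jk.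
Qed.

Lemma gap_left_ge0 j : 0 <= gap_left j.
Proof. exact: sum_over_ge0. Qed.

Lemma gap_right_le_total j : gap_right j <= total_length.
Proof. by rewrite gap_right_sum; apply: sum_over_sub. Qed.

Lemma gap_right_lt i j : prec i j -> gap_right i + b j <= gap_right j.
Proof. by move=> ij; rewrite /gap_right lerD2r; exact: gap_right_le_left. Qed.

Lemma gap_right_mono i j : gap_right i <= gap_right j -> ~~ prec j i.
Proof.
move=> le; apply/negP => /gap_right_lt h.
by have := le_trans h le; rewrite gerDl leNgt b_gt0.
Qed.

Lemma gap_left_mono i j : gap_left i <= gap_left j -> ~~ prec j i.
Proof.
move=> le; apply/negP => /gap_right_le_left h.
by have := le_trans h le; rewrite leNgt gap_left_lt_right.
Qed.

Lemma gap_right_arrangement j : arrangement (gap_right j).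
Proof.
split; first by rewrite gap_right_le_total andbT addr_ge0 ?gap_left_ge0 ?ltW.
move=> i /andP[h1 h2].
have := prec_total (i := i) (j := j); case: eqVneq h1 h2 => [->|ne] h1 h2.
  by rewrite ltxx in h2.
case/(_ isT)/orP => /gap_right_le_left h; first last.
  by have := le_lt_trans h h1; rewrite ltxx.
have := lt_le_trans h2 h; rewrite /gap_right => h3.
by have := lt_trans h3 (gap_left_lt_right j); rewrite ltxx.
Qed.

(** The finitely many gaps of index below n that lie to the left of y fit between 0 and
    the right end of the last of them. *)
Lemma sum_left_le y : 0 <= y -> sum_over b (fun i => gap_right i <= y) <= y.
Proof.
move=> y0; apply: sum_over_le => // n.
case: (pickP (fun i : 'I_n => gap_right i <= y)) => [i0 Pi0|P0]; last first.
  by rewrite big_pred0.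
case: (@arg_maxP _ _ _ i0 (fun i : 'I_n => gap_right i <= y)
  (fun i : 'I_n => gap_right i) Pi0) => j jy jmax.
apply: le_trans jy; rewrite gap_right_sum.
apply: le_trans (partial_sum_le b_gt0 b_cvg _ n).
rewrite big_mkcond [leRHS]big_mkcond ler_sum// => i _.
case: ifP => [iy|_]; last by case: ifP => // _; exact: ltW.
by rewrite gap_right_mono //; exact: jmax.
Qed.

Lemma sum_right_le y : y <= total_length ->
  sum_over b (fun i => y <= gap_left i) <= total_length - y.
Proof.
move=> y0; apply: sum_over_le => // n.
case: (pickP (fun i : 'I_n => y <= gap_left i)) => [i0 Pi0|P0]; last first.
  by rewrite big_pred0 // subr_ge0.
case: (@arg_minP _ _ _ i0 (fun i : 'I_n => y <= gap_left i)
  (fun i : 'I_n => gap_left i) Pi0) => j jy jmin.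
apply: (@le_trans _ _ (total_length - gap_left j)); last by rewrite lerB.
have -> : total_length - gap_left j = sum_over b (fun i => ~~ prec i j).
  rewrite /total_length (@sum_overD _ _ b_gt0 b_cvg (fun i => ~~ prec i j)
    (fun i => prec i j)) ?addrK // => i; first by rewrite orNb.
  by move=> /negP.
apply: le_trans (partial_sum_le b_gt0 b_cvg _ n).
rewrite big_mkcond [leRHS]big_mkcond ler_sum// => i _.
case: ifP => [iy|_]; last by case: ifP => // _; exact: ltW.
by rewrite gap_left_mono //; exact: jmin.
Qed.

(** The gaps on the two sides of a point y of the arrangement exhaust all the gaps;
    since those on the left add up to at most y, those on the right to at most the rest,
    and all of them to the whole, both bounds are equalities: the arrangement carries
    no length of its own. *)
Lemma arrangement_sum_left y : arrangement y -> y = sum_over b (fun i => gap_right i <= y).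
Proof.
move=> [/andP[y0 yL] yg].
have tot : total_length = sum_over b (fun i => gap_right i <= y)
    + sum_over b (fun i => y <= gap_left i).
  apply: (@sum_overD _ _ b_gt0 b_cvg) => i; last first.
    by move=> h1 h2; have := le_lt_trans h2 (gap_left_lt_right i); rewrite ltNge h1.
  have := yg i; case: (leP (gap_right i) y) => //= h1.
  by case: (leP y (gap_left i)) => //= h2 /(_ isT).
have := sum_left_le y0; have := sum_right_le yL; lra.
Qed.

Lemma arrangement_dist y1 y2 : arrangement y1 -> arrangement y2 -> y1 <= y2 ->
  y2 - y1 = sum_over b (fun i => (y1 <= gap_left i) && (gap_right i <= y2)).
Proof.
move=> E1 E2 y12; rewrite {1}(arrangement_sum_left E1) {1}(arrangement_sum_left E2).
rewrite (@sum_overD _ _ b_gt0 b_cvg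
  (fun i => (y1 <= gap_left i) && (gap_right i <= y2)) (fun i => gap_right i <= y1));
  first by rewrite addrK.
- move=> i; have [_ /(_ i)] := E1.
  case: (leP (gap_right i) y1) => [h|h]; first by rewrite orbT (le_trans h).
  by rewrite orbF; case: (leP y1 (gap_left i)) => //= h2 /(_ isT).
- by move=> i /andP[h _] h2; have := le_lt_trans h (gap_left_lt_right i); rewrite ltNge h2.
Qed.

Lemma complementary_arrangement (a : nat -> R) :
  (forall i, b i = a i.+1) -> complementary_set a arrangement.
Proof.
move=> ba; exists total_length; split.
  rewrite (_ : (fun n => _) = (fun n => \sum_(i < n) b i)).
    exact: (@sum_over_cvg _ _ b_gt0 b_cvg xpredT).
  apply/funext => n; rewrite big_add1 /= big_mkord; apply: eq_bigr => i _.
  by rewrite ba.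
exists (fun j => gap_left j.-1), (fun j => gap_right j.-1).
have set_eq : arrangement = `[0, total_length]%classic `\`
   \bigcup_(j in [set j | (1 <= j)%N]) `]gap_left j.-1, gap_right j.-1[%classic.
  apply/seteqP; split => y /=.
    move=> [y01 yg]; split; first by rewrite in_itv.
    by case=> j /= j1; rewrite in_itv /=; exact: yg.
  rewrite in_itv /= => -[y01 yg]; split => // j jy; apply: yg.
  by exists j.+1; rewrite //= in_itv.
split => //.
- case=> // j _ /=; split; first by rewrite /gap_right addrC addKr.
  move=> y /=; rewrite !in_itv /= => /andP[h1 h2]; apply/andP; split.
    exact: le_trans (gap_left_ge0 j) (ltW h1).
  exact: le_trans (ltW h2) (gap_right_le_total j).
- move=> [|i] [|j] //= _ _ [y /=]; rewrite !in_itv /= => -[/andP[h1 h2] /andP[h3 h4]].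
  have [->//|ne] := eqVneq i j.
  case/orP: (prec_total ne) => /gap_right_le_left h.
    by have := lt_trans h2 (le_lt_trans h h3); rewrite ltxx.
  by have := lt_trans h4 (le_lt_trans h h1); rewrite ltxx.
- rewrite set_eq setDE; apply: closedI.
    by apply: interval_closed.
  by apply: open_closedC; apply: bigcup_open => j _; exact: interval_open.
Qed.

End Arrangement.

(** * Covering numbers and Assouad dimension on the line *)

Section Assouad.
Variable R : realType.
Implicit Types (E F : set R) (e d x y : R).

Lemma in_closed_ball x e y : 0 < e -> closed_ball x e y <-> `|x - y| <= e.
Proof. by move=> e0; rewrite closed_ballE. Qed.

Lemma covering_number_le e F (n : nat) (c : nat -> R) :
  F `<=` \bigcup_(i < n) closed_ball (c i) e -> (covering_number e F <= n%:R%:E)%E.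
Proof. by move=> Fc; apply: ereal_inf_lbound; exists n => //; exists c. Qed.

(** A ball of radius e contains at most one of several points at mutual distance
    more than 2e. *)
Lemma separated_covering_number (T : finType) (pts : T -> R) e F :
  0 < e -> (forall i, F (pts i)) ->
  (forall i j, i != j -> 2 * e < `|pts i - pts j|) ->
  (#|T|%:R%:E <= covering_number e F)%E.
Proof.
move=> e0 Fp sep; apply: le_ereal_inf_tmp => _ [n [c Fc] <-].
rewrite lee_fin ler_nat.
have h i : {k : 'I_n | `|c k - pts i| <= e}.
  apply: cid; have [k kn hk] := Fc _ (Fp i); exists (Ordinal kn) => /=.
  by apply/in_closed_ball.
rewrite -[n]card_ord; apply: (@leq_card _ _ (fun i => sval (h i))) => i j eij.
apply/eqP/negPn/negP => /sep; apply/negP; rewrite -leNgt.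
have := svalP (h i); have := svalP (h j); rewrite -eij.
set z := c _ => hj hi; have -> : pts i - pts j = (z - pts j) - (z - pts i) by ring.
by apply: le_trans (ler_normB _ _) _; lra.
Qed.

Lemma assouad_dim_le E (c alpha : R) : 0 < c ->
  (forall e d x, 0 < e -> e < d -> E x ->
     (covering_number e (closed_ball x d `&` E) <= (c * (d / e) `^ alpha)%:E)%E) ->
  (assouad_dim E <= alpha%:E)%E.
Proof.
move=> c0 h; apply: ereal_inf_lbound; exists alpha => //; exists c, 1; split => //.
by move=> e d e0 ed _; apply: ge_ereal_sup => _ [x Ex <-]; exact: h.
Qed.

Lemma assouad_dim_le1 E : (assouad_dim E <= 1%:E)%E.
Proof.
apply: (@assouad_dim_le _ 2) => // e d x e0 ed _.
have de : 1 < d / e by rewrite ltr_pdivlMr // mul1r.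
set n := (Num.truncn (d / e)).+1.
have nle : n%:R <= 2 * (d / e).
  have : (Num.truncn (d / e))%:R <= d / e by rewrite Num.Theory.truncn_le // ltW// (lt_trans _ de).
  rewrite /n -natr1; lra.
(* Consecutive balls of radius e starting from the left end of the big ball. *)
have := @covering_number_le e (closed_ball x d `&` E) n (fun i => x - d + (2 * i%:R + 1) * e).
move=> h; apply: (@le_trans _ _ n%:R%:E); last first.
  by rewrite lee_fin powRr1 // ltW // (lt_trans _ de).
apply: h => y [/in_closed_ball]; rewrite (lt_trans e0 ed) => /(_ isT) xy _.
move: xy; rewrite ler_norml => /andP[xy1 xy2].
set z := (y - (x - d)) / (2 * e).
have z0 : 0 <= z by apply: divr_ge0; lra.
have zd : z <= d / e.
  rewrite /z ler_pdivrMr; last by lra.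
  have -> : d / e * (2 * e) = 2 * d by field; lra.
  lra.
have /andP[k1 k2] := truncn_itv z0.
exists (Num.truncn z); first by rewrite /= ltnS; apply: le_truncn.
apply/in_closed_ball => //.
have yz : y = x - d + z * (2 * e) by rewrite /z; field; lra.
rewrite yz ler_norml; move: k2; rewrite -natr1 => k2.
set k := (Num.truncn z)%:R in k1 k2 *.
have := ler_wpM2r (ltW e0) k1; have := ler_wpM2r (ltW e0) (ltW k2).
by rewrite mulrDl mul1r => h1 h2; apply/andP; split; lra.
Qed.

(** A bound c (d/e)^alpha with alpha < s on the covering numbers in the hypothesis would bound
    2^(k (1 - alpha/s)) uniformly in k. *)
Lemma assouad_dim_ge E (s B : R) : 0 < s ->
  (forall (rho : R) (k0 : nat), 0 < rho -> exists (k : nat) (d e x : R),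
     [/\ (k0 <= k)%N, 0 < e, e < d, d < rho & 
     [/\ d / e <= B * (2 ^+ k) `^ s^-1, E x &
      ((2 ^+ k)%:E <= covering_number e (closed_ball x d `&` E))%E]]) ->
  (s%:E <= assouad_dim E)%E.
Proof.
move=> s0 h; apply: le_ereal_inf_tmp => _ [alpha [c [rho [c0 rho0 hc]]] <-].
rewrite lee_fin leNgt; apply/negP => alphas.
(* A negative exponent is only stronger than 0, as e < d. *)
set beta := Num.max alpha 0.
have beta0 : 0 <= beta by rewrite le_max lexx orbT.
have alphabeta : alpha <= beta by rewrite le_max lexx.
have betas : beta < s by rewrite gt_max alphas.
set g := 1 - beta / s.
have g0 : 0 < g by rewrite subr_gt0 ltr_pdivrMr ?mul1r.
set D := c * B `^ beta.
have [k0 hk0] : exists k0 : nat, D `^ g^-1 < k0%:R.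
  exists (Num.truncn (D `^ g^-1)).+1; exact: truncnS_gt.
have [k [d [e [x [kk0 e0 ed drho [de Ex hcov]]]]]] := h _ k0 rho0.
have de1 : 1 <= d / e by rewrite ler_pdivlMr // mul1r ltW.
have B0 : 0 <= B.
  rewrite leNgt; apply/negP => Bn; have := le_trans de1 de.
  rewrite leNgt (@le_lt_trans _ _ 0) //.
  by apply: mulr_le0_ge0; rewrite ?powR_ge0 // ltW.
have p2 : (0 : R) < 2 ^+ k by rewrite exprn_gt0.
have b1 : 2 ^+ k <= c * (d / e) `^ beta.
  rewrite -lee_fin; apply: le_trans hcov _.
  apply: (@le_trans _ _ (c * (d / e) `^ alpha)%:E).
    apply: le_trans (hc e d e0 ed drho); apply: ereal_sup_ubound; by exists x.
  by rewrite lee_fin ler_pM2l // ler_powR.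
have b2 : 2 ^+ k <= D * (2 ^+ k) `^ (beta / s).
  apply: le_trans b1 _; rewrite /D -mulrA ler_pM2l //.
  rewrite [beta / s]mulrC powRrM -powRM // ?powR_ge0 //.
  apply: ge0_ler_powR => //; rewrite nnegrE; first exact: le_trans de1.
  by rewrite mulr_ge0 ?powR_ge0.
have b3 : (2 ^+ k) `^ g <= D.
  rewrite /g powRB; last by apply/implyP => _; rewrite gt_eqF.
  by rewrite powRr1 ?(ltW p2) // ler_pdivrMr ?powR_gt0.
have b4 : 2 ^+ k <= D `^ g^-1.
  have -> : (2 : R) ^+ k = ((2 ^+ k) `^ g) `^ g^-1.
    by rewrite -powRrM mulfV ?gt_eqF // powRr1 // ltW.
  apply: ge0_ler_powR => //; rewrite ?nnegrE ?powR_ge0 ?invr_ge0 ?(ltW g0) //.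
  by apply: mulr_ge0; rewrite ?powR_ge0 // ltW.
have := le_lt_trans b4 hk0; rewrite -natrX ltr_nat => h1.
have := leq_trans h1 kk0; by rewrite ltnNge ltnW // ltn_expl.
Qed.

End Assouad.

(** * Binary words in symmetric order *)

(** The in-order traversal of the infinite binary tree: a word comes after its extensions
    by false and before its extensions by true. *)
Fixpoint ltw (x y : seq bool) : bool :=
  match x, y with
  | [::], [::] => false
  | [::], b :: _ => b
  | b :: _, [::] => ~~ b
  | b :: x', c :: y' => if b == c then ltw x' y' else c
  end.

Lemma ltwxx x : ltw x x = false.
Proof. by elim: x => //= b x ->; rewrite eqxx. Qed.

Lemma ltw_trans : transitive ltw.
Proof. by move=> y x; elim: x y => [|[] x IH] [|[] y] [|[] z] //=; exact: IH. Qed.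

Lemma ltw_total x y : x != y -> ltw x y || ltw y x.
Proof.
elim: x y => [|[] x IH] [|[] y] //=.
- by rewrite eqseq_cons eqxx /=; exact: IH.
- by rewrite eqseq_cons eqxx /=; exact: IH.
Qed.

Lemma ltw_prefix_convex p x y z :
  prefix p x -> prefix p z -> ltw x y -> ltw y z -> prefix p y.
Proof.
elim: p x y z => [|b p IH] [|c x] [|d y] [|f z]; rewrite ?prefix0s ?prefix_cons //.
  by move=> /andP[/eqP <- _] /andP[/eqP <- _] /=; case: b.
move=> /andP[/eqP <- px] /andP[/eqP <- pz] /=.
by case: b; case: d => //=; exact: IH.
Qed.

(** The witness is the longest common prefix of the two words. *)
Lemma ltw_meet x y : prefix x y \/ exists c, [/\ prefix c x, (size c < size x)%N &
  [\/ c = y, ltw x c && ltw c y | ltw y c && ltw c x]].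
Proof.
elim: x y => [|b x IH] y; first by left; rewrite prefix0s.
case: y => [|d y].
  by right; exists [::]; split => //; constructor 1.
have [<-|bd] := eqVneq b d.
  case: (IH y) => [p|[c [p sz h]]]; first by left; rewrite prefix_cons eqxx.
  right; exists (b :: c); split => //; first by rewrite prefix_cons eqxx.
  by case: h => h; [constructor 1; rewrite h|constructor 2|constructor 3];
    rewrite //= eqxx.
right; exists [::]; split => //.
by case: b d bd => [] [] // _; [constructor 3|constructor 2].
Qed.

(** * Gaps arranged along a binary tree *)

(** The common ratio of a self-similar Cantor set of dimension s made of two pieces. *)
Definition dim_ratio (R : realType) (s : R) : R := 2 `^ (- s^-1).

Section Ratio.
Variable R : realType.
Implicit Types s : R.

Lemma dim_ratio_gt0 s : 0 < dim_ratio s.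
Proof. by rewrite powR_gt0. Qed.

Lemma dim_ratioX s k : dim_ratio s ^+ k = ((2 ^+ k) `^ s^-1)^-1.
Proof.
rewrite -powR_mulrn ?ltW ?dim_ratio_gt0 // -powRrM mulNr powRN; congr (_^-1).
by rewrite mulrC powRrM powR_mulrn.
Qed.

Lemma dim_ratioXV_powR s k : 0 < s -> (dim_ratio s ^- k) `^ s = 2 ^+ k.
Proof.
move=> s0; rewrite dim_ratioX invrK -powRrM mulVf ?gt_eqF // powRr1 //.
Qed.

Lemma dim_ratio_le s t : 0 < s -> s <= t -> dim_ratio s <= dim_ratio t.
Proof.
move=> s0 st; apply: ler_powR; first by lra.
by rewrite lerN2 lef_pV2 // posrE // (lt_le_trans s0).
Qed.

Lemma dim_ratio1 : dim_ratio 1 = 1 / 2 :> R.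
Proof. by rewrite /dim_ratio invr1 powR_inv1 // div1r. Qed.

Lemma dim_ratio_lt12 s : 0 < s -> s < 1 -> dim_ratio s < 1 / 2.
Proof.
move=> s0 s1; rewrite -dim_ratio1 /dim_ratio invr1 powR_inv1 // powRN ltf_pV2 ?posrE ?powR_gt0 //.
have t0 : 0 < s^-1 - 1 by rewrite subr_gt0 invf_gt1.
have h : 1 < (2 : R) `^ (s^-1 - 1).
  have := @gt0_ltr_powR _ _ t0 1 2; rewrite !nnegrE powR1; apply => //.
  by rewrite ltr1n.
have -> : s^-1 = (s^-1 - 1) + 1 by ring.
rewrite powRD; last by apply/implyP.
by rewrite powRr1 // ltr_pMl.
Qed.

End Ratio.

Section TreeOrder.
Variables (nu : nat -> seq bool).
Hypothesis nu_inj : injective (fun i => (nu i, odd i)).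
Hypothesis nu_prefix : forall i p, prefix p (nu i) -> exists j, nu j = p.

(** Several gaps may sit at the same node; they are then placed side by side. *)
Definition tree_prec : rel nat :=
  fun i j => ltw (nu i) (nu j) || (nu i == nu j) && (i < j)%N.

Lemma tree_precxx i : tree_prec i i = false.
Proof. by rewrite /tree_prec ltwxx ltnn andbF. Qed.

Lemma tree_prec_trans : transitive tree_prec.
Proof.
move=> j i k /orP[h1|/andP[/eqP h1 ij]] /orP[h2|/andP[/eqP h2 jk]]; apply/orP.
- by left; exact: ltw_trans h2.
- by left; rewrite -h2.
- by left; rewrite h1.
- by right; rewrite h1 h2 eqxx (ltn_trans ij).
Qed.

Lemma tree_prec_total i j : i != j -> tree_prec i j || tree_prec j i.
Proof.
move=> ij; rewrite /tree_prec; have [e|ne] := eqVneq (nu i) (nu j).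
  by rewrite e !ltwxx /= -neq_ltn.
by rewrite !orbF; exact: ltw_total.
Qed.

Lemma subtree_convex p i j k : prefix p (nu i) -> prefix p (nu k) ->
  tree_prec i j -> tree_prec j k -> prefix p (nu j).
Proof.
move=> pi pk /orP[ij|/andP[/eqP <- _]] // /orP[jk|/andP[/eqP -> _]] //.
exact: ltw_prefix_convex ij jk.
Qed.

(** A node of least depth in a convex set of gaps is an ancestor of every other one,
    because the meet of two nodes lies between them. *)
Lemma convex_top (Q : pred nat) i1 :
  (forall i j k, Q i -> Q k -> tree_prec i j -> tree_prec j k -> Q j) -> Q i1 ->
  exists2 i0, Q i0 & forall i, Q i -> prefix (nu i0) (nu i).
Proof.
move=> Qconv Qi1.
have : exists n, `[< exists2 i, Q i & size (nu i) = n >].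
  by exists (size (nu i1)); apply/asboolP; exists i1.
move=> /ex_minnP[m /asboolP[i0 Qi0 sz] mmin]; exists i0 => // i Qi.
case: (ltw_meet (nu i0) (nu i)) => // -[c [pc szc h]]; exfalso.
have [j jc] := nu_prefix pc.
suff Qj : Q j.
  have : (m <= size (nu j))%N by apply: mmin; apply/asboolP; exists j.
  by rewrite jc -sz leqNgt szc.
case: h => [ci|/andP[h1 h2]|/andP[h1 h2]].
- have : (m <= size (nu i))%N by apply: mmin; apply/asboolP; exists i.
  by rewrite -ci -sz leqNgt szc.
- by apply: (Qconv i0 j i) => //; rewrite /tree_prec jc ?h1 ?h2.
- by apply: (Qconv i j i0) => //; rewrite /tree_prec jc ?h1 ?h2.
Qed.

Lemma subtree_level_count p k n :
  (#|[pred i : 'I_n | prefix p (nu i) && (size (nu i) == size p + k)%N]| <= 2 * 2 ^ k)%N.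
Proof.
set P := [pred i : 'I_n | _].
pose f (i : 'I_n) : k.-tuple bool * bool :=
  ([tuple nth false (nu i) (size p + x) | x < k], odd i).
have finj : {in P &, injective f}.
  move=> i j /andP[/prefixP[u iu] /eqP szi] /andP[/prefixP[w jw] /eqP szj] fij.
  apply: val_inj; apply: nu_inj => /=.
  congr (_, _); last exact: (congr1 snd fij).
  rewrite iu jw in szi szj *; congr (_ ++ _).
  move: szi szj; rewrite !size_cat => /addnI szi /addnI szj.
  apply: (@eq_from_nth _ false); rewrite ?szi ?szj // => x xk.
  have := congr1 (fun t => tnth t.1 (Ordinal xk)) fij; rewrite !tnth_mktuple /=.
  by rewrite iu jw !nth_cat !ltnNge !leq_addr /= !addKn.
rewrite -(card_in_image finj); apply: leq_trans (max_card _) _.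
by rewrite card_prod card_tuple card_bool mulnC.
Qed.

Variable R : realType.

Lemma subtree_sum_le (f : nat -> R) p K n : (forall k, 0 <= f k) ->
  \sum_(i < n | prefix p (nu i) && (size (nu i) - size p < K)%N) f (size (nu i) - size p)%N
  <= \sum_(k < K) 2 * 2 ^+ k * f k.
Proof.
move=> f0.
pose P (i : 'I_n) (k : 'I_K) := prefix p (nu i) && (size (nu i) == size p + k)%N.
apply: (@le_trans _ _ (\sum_(i < n) \sum_(k < K | P i k) f k)).
  rewrite big_mkcond ler_sum // => i _; case: ifP => [/andP[pi sz]|_]; last first.
    by apply: sumr_ge0.
  rewrite (bigD1 (Ordinal sz)) /=; last first.
    by rewrite /P pi /= subnKC // size_prefix.
  by rewrite lerDl sumr_ge0.
rewrite (exchange_big_dep xpredT) //= ler_sum // => k _.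
rewrite sumr_const -[leLHS]mulr_natl ler_wpM2r // -natrX -natrM ler_nat.
exact: subtree_level_count.
Qed.

End TreeOrder.

(** * Dimension of tree arrangements *)

Section TreeDimension.
Variables (R : realType) (b : nat -> R) (nu : nat -> seq bool) (alpha C : R).
Hypothesis b_gt0 : forall i, 0 < b i.
Hypothesis b_cvg : cvgn (fun n => \sum_(i < n) b i).
Hypothesis nu_inj : injective (fun i => (nu i, odd i)).
Hypothesis nu_prefix : forall i p, prefix p (nu i) -> exists j, nu j = p.
Hypothesis alpha_gt0 : 0 < alpha.
Hypothesis alpha_lt1 : alpha < 1.
Hypothesis b_decay : forall i j, prefix (nu i) (nu j) ->
  b j <= C * b i * dim_ratio alpha ^+ (size (nu j) - size (nu i)).

Let prec := tree_prec nu.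
Let E := arrangement b prec.
Let u := gap_left b prec.
Let v := gap_right b prec.
Let u_lt_v := gap_left_lt_right prec b_gt0.
Let v_le_u := gap_right_le_left b_gt0 b_cvg (tree_precxx nu) (@tree_prec_trans nu)
  (@tree_prec_total nu).
Let v_E := gap_right_arrangement b_gt0 b_cvg (tree_precxx nu) (@tree_prec_trans nu)
  (@tree_prec_total nu).
Let E_dist := arrangement_dist b_gt0 b_cvg (tree_precxx nu) (@tree_prec_trans nu)
  (@tree_prec_total nu).

Let K : R := C * (2 / (1 - 2 * dim_ratio alpha)).

Lemma decay_constant_ge1 : 1 <= C.
Proof.
have := b_decay (prefix_refl (nu 0)); rewrite subnn expr0 mulr1.
by rewrite -{1}[b 0%N]mul1r ler_pM2r.
Qed.

Lemma ratio_series_gt0 : 0 < 1 - 2 * dim_ratio alpha.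
Proof. by have := dim_ratio_lt12 alpha_gt0 alpha_lt1; lra. Qed.

Lemma subtree_constant_gt1 : 1 < K.
Proof.
have C1 := decay_constant_ge1; have q0 := dim_ratio_gt0 alpha; have q1 := ratio_series_gt0.
rewrite /K; have : 2 < 2 / (1 - 2 * dim_ratio alpha).
  rewrite ltr_pdivlMr //; lra.
by move=> h; nra.
Qed.

(** The numbers of nodes grow by a factor 2 from a level to the next while the gaps shrink
    by dim_ratio alpha < 1/2, so that the gaps of a subtree add up to a multiple of the gap at
    its root. *)
Lemma subtree_total_le i0 :
  sum_over b (fun i => prefix (nu i0) (nu i)) <= K * b i0.
Proof.
apply: sum_over_le => // n; set q := dim_ratio alpha; set m := size (nu i0).
have q0 : 0 < q by exact: dim_ratio_gt0.
have C0 : 0 <= C by apply: le_trans decay_constant_ge1.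
(* A bound on the depths of the finitely many gaps considered. *)
pose N := (\max_(i < n) (size (nu i))).+1.
have szN (i : 'I_n) : (size (nu i) - m < N)%N.
  by rewrite ltnS (leq_trans (leq_subr _ _)) // (leq_bigmax i).
apply: (@le_trans _ _ (\sum_(i < n | prefix (nu i0) (nu i) && (size (nu i) - m < N)%N)
   (fun k => C * b i0 * q ^+ k) (size (nu i) - m)%N)).
  rewrite big_mkcond [leRHS]big_mkcond ler_sum // => i _; rewrite szN andbT.
  by case: ifP => // pi; exact: b_decay.
apply: le_trans (@subtree_sum_le nu nu_inj R (fun k => C * b i0 * q ^+ k) (nu i0) N n _) _.
  by move=> k; rewrite !mulr_ge0 ?exprn_ge0 // ltW.
have q2 := ratio_series_gt0; rewrite -/q in q2.
have geo M : \sum_(k < M) (2 * q) ^+ k <= (1 - 2 * q)^-1.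
  rewrite -[leRHS]mul1r ler_pdivlMr //.
  have -> : (\sum_(k < M) (2 * q) ^+ k) * (1 - 2 * q) = 1 - (2 * q) ^+ M.
    by apply: oppr_inj; rewrite opprB subrX1; ring.
  by rewrite gerBl exprn_ge0 // mulr_ge0 // ltW.
have -> : \sum_(k < N) 2 * 2 ^+ k * (C * b i0 * q ^+ k) =
  2 * C * b i0 * \sum_(k < N) (2 * q) ^+ k.
  by rewrite mulr_sumr; apply: eq_bigr => k _; rewrite exprMn; ring.
rewrite (_ : K * b i0 = 2 * C * b i0 * (1 - 2 * q)^-1).
  apply: ler_wpM2l; last exact: geo.
  by rewrite !mulr_ge0 // ltW.
by rewrite /K -/q; ring.
Qed.

(** A gap of size at least r in the subtree at i0 has depth k below i0 with
    r <= C (b i0) 2^(-k/alpha), that is 2^k <= (C (b i0) / r)^alpha. *)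
Lemma subtree_large_count i0 (r : R) n : 0 < r ->
  (#|[pred i : 'I_n | prefix (nu i0) (nu i) && (r <= b i)]|%:R : R)
  <= 4 * (C * b i0 / r) `^ alpha.
Proof.
move=> r0; set q := dim_ratio alpha; set m := size (nu i0); set P := [pred i : 'I_n | _].
set Y := (_ `^ alpha).
have q0 : 0 < q by exact: dim_ratio_gt0.
have C0 : 0 < C by apply: lt_le_trans decay_constant_ge1.
case: (pickP P) => [i1 Pi1|P0]; last first.
  by rewrite (eq_card0 P0) mulr_ge0 // powR_ge0.
case: (@arg_maxnP _ i1 P (fun i : 'I_n => size (nu i)) Pi1) => j /andP[pj rj] jmax.
set k := (size (nu j) - m)%N.
have kY : 2 ^+ k <= Y.
  rewrite -(dim_ratioXV_powR k alpha_gt0) -/q.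
  apply: ge0_ler_powR; first exact: ltW.
  - by rewrite nnegrE invr_ge0 exprn_ge0 // ltW.
  - by rewrite nnegrE ltW // divr_gt0 // mulr_gt0.
  rewrite ler_pdivlMr // mulrC ler_pdivrMr ?exprn_gt0 //.
  exact: le_trans rj (b_decay pj).
have cnt : (#|P|%:R : R) <= \sum_(l < k.+1) 2 * 2 ^+ l * 1.
  have := @subtree_sum_le nu nu_inj R (fun _ => 1) (nu i0) k.+1 n (fun _ => ler01).
  apply: le_trans; rewrite -sum1_card natr_sum.
  rewrite big_mkcond [leRHS]big_mkcond ler_sum // => i _.
  case: ifP => [Pi|_]; last by case: ifP.
  have [pi ri] := andP Pi; rewrite pi ltnS leq_sub2r //.
  exact: jmax.
apply: le_trans cnt _.
have -> : \sum_(l < k.+1) 2 * 2 ^+ l * 1 = 2 * (2 ^+ k.+1 - 1) :> R.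
  rewrite -mulr_suml mulr1 -mulr_sumr subrX1.
  by rewrite (_ : 2 - 1 = 1) ?mul1r //; ring.
by move: kY; rewrite exprS; lra.
Qed.

Lemma gaps_between_convex x y i j k :
  (x <= u i) && (v i <= y) -> (x <= u k) && (v k <= y) -> prec i j -> prec j k ->
  (x <= u j) && (v j <= y).
Proof.
move=> /andP[xi _] /andP[_ ky] /v_le_u ij /v_le_u jk; apply/andP; split.
  by apply: le_trans xi (le_trans (ltW (u_lt_v i)) ij).
by apply: le_trans jk (le_trans (ltW (u_lt_v k)) ky).
Qed.

Lemma gaps_between_top x y i : (x <= u i) && (v i <= y) ->
  exists2 i0, (x <= u i0) && (v i0 <= y) &
    forall j, (x <= u j) && (v j <= y) -> prefix (nu i0) (nu j).
Proof.
move=> h; apply: (@convex_top _ nu_prefix (fun i => (x <= u i) && (v i <= y)) i) => //.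
by move=> i' j' k'; exact: gaps_between_convex.
Qed.

Lemma tree_arrangement_dist_le x y (r : R) : E x -> E y -> x <= y -> 0 <= r ->
  (forall i, x <= u i -> v i <= y -> K * b i <= r) -> y - x <= r.
Proof.
move=> Ex Ey xy r0 small; rewrite (E_dist Ex Ey xy).
have [[i hi]|none] := pselect (exists i, (x <= u i) && (v i <= y)); last first.
  apply: sum_over_le => // n; rewrite big_pred0 // => i; apply/negP => h.
  by apply: none; exists i.
have [i0 /andP[h1 h2] top] := gaps_between_top hi.
apply: le_trans (small _ h1 h2); apply: le_trans (subtree_total_le i0).
by apply: sum_over_sub => // j; exact: top.
Qed.

(** The points of E in a ball of radius d are sorted by the number of gaps of size at least
    e / K to their left within the ball: two points with the same number are at
    distance at most e, and the number of such gaps is controlled by the topmost one. *)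
Lemma tree_covering_number_le e d x : 0 < e -> e < d -> E x ->
  (covering_number e (closed_ball x d `&` E)
   <= ((4 * (2 * C * K) `^ alpha + 1) * (d / e) `^ alpha)%:E)%E.
Proof.
move=> e0 ed Ex; have d0 := lt_trans e0 ed.
have K1 := subtree_constant_gt1; have K0 : 0 < K by apply: lt_trans K1.
have C0 : 0 < C by apply: lt_le_trans decay_constant_ge1.
set r := e / K; have r0 : 0 < r by rewrite divr_gt0.
have [n bn] : exists n, forall i, (n <= i)%N -> b i < r.
  have : b @ \oo --> (0 : R).
    apply: cvg_series_cvg_0; rewrite (_ : series b = (fun n => \sum_(i < n) b i)) //.
    by apply/funext => n; rewrite /series /= big_mkord.
  move=> /cvgrPdist_lt /(_ _ r0)[n _ hn]; exists n => i ni.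
  by have := hn i ni; rewrite /= sub0r normrN gtr0_norm.
(* The gaps of J with v i <= y, counted by N y, determine y up to e. *)
pose J := [pred i : 'I_n | [&& r <= b i, x - d <= u i & v i <= x + d]].
pose F := closed_ball x d `&` E.
pose N y := #|[pred i : 'I_n | J i && (v i <= y)]|.
have close y1 y2 : F y1 -> F y2 -> y1 <= y2 -> N y1 = N y2 -> y2 - y1 <= e.
  move=> [/(in_closed_ball _ _ d0) b1 E1] [/(in_closed_ball _ _ d0) b2 E2] y12 eN.
  apply: tree_arrangement_dist_le => //; first exact: ltW.
  move=> i h1 h2; rewrite leNgt; apply/negP => h3.
  have ri : r < b i by rewrite /r ltr_pdivrMr // mulrC.
  have ni : (i < n)%N by rewrite ltnNge; apply/negP => /bn; rewrite ltNge ltW.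
  have : (N y1 < N y2)%N.
    apply: proper_card; apply/properP; split.
      apply/fintype.subsetP => k; rewrite !inE => /andP[-> h] /=; exact: le_trans y12.
    exists (Ordinal ni); rewrite !inE /=; last first.
      by rewrite negb_and -ltNge (le_lt_trans h1) ?orbT //; exact: u_lt_v.
    rewrite h2 andbT (ltW ri) /=; move: b1 b2; rewrite !ler_norml.
    move=> /andP[l1 l2] /andP[l3 l4]; apply/andP; split;
      [apply: le_trans h1|apply: le_trans h2 _]; lra.
  by rewrite eN ltnn.
have Nle y : (N y < #|J|.+1)%N.
  by rewrite ltnS; apply: subset_leq_card; apply/fintype.subsetP => k /andP[].
apply: (@le_trans _ _ (#|J|.+1%:R%:E)).
  apply: (@covering_number_le _ _ _ _ (fun k => xget 0 [set y | F y /\ N y = k])).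
  move=> y Fy; exists (N y); first exact: Nle.
  have [Fz eN] := @xgetPex _ 0 [set z | F z /\ N z = N y] (ex_intro _ y (conj Fy erefl)).
  set z := xget _ _ in Fz eN *; apply/in_closed_ball => //.
  have [zy|/ltW yz] := leP z y.
    by rewrite distrC ger0_norm ?subr_ge0 //; exact: close.
  by rewrite ger0_norm ?subr_ge0 //; exact: close.
have de1 : 1 <= d / e by rewrite ler_pdivlMr // mul1r ltW.
have dea : 1 <= (d / e) `^ alpha.
  by rewrite -[leLHS](powRr0 (d / e)) ler_powR // ltW.
rewrite lee_fin -natr1 mulrDl mul1r lerD //.
case: (pickP J) => [i1 /and3P[_ h1 h2]|J0]; last first.
  by rewrite (eq_card0 J0) !mulr_ge0 // powR_ge0.
have [i0 /andP[xi ix] top] := gaps_between_top (introT andP (conj h1 h2)).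
have bi0 : b i0 <= 2 * d.
  have : v i0 = u i0 + b i0 by [].
  lra.
apply: (@le_trans _ _ (4 * (C * b i0 / r) `^ alpha)).
  apply: le_trans (subtree_large_count i0 n r0); rewrite ler_nat.
  apply: subset_leq_card; apply/fintype.subsetP => k; rewrite !inE => /and3P[-> h3 h4].
  by rewrite andbT; apply: top; rewrite h3.
have de0 : 0 <= d / e by exact: le_trans ler01 de1.
have CK0 : 0 <= 2 * C * K by apply: mulr_ge0; [apply: mulr_ge0|]; rewrite // ltW.
rewrite -[leRHS]mulrA -(powRM alpha CK0 de0); apply: ler_wpM2l => //.
have Er : C * b i0 / r = C * b i0 * K / e by rewrite /r; field; rewrite !gt_eqF.
apply: ge0_ler_powR; rewrite ?nnegrE ?Er.
- exact: ltW.
- by apply: divr_ge0 (ltW e0); apply: mulr_ge0 (ltW K0); apply: mulr_ge0; exact: ltW.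
- exact: mulr_ge0.
have -> : 2 * C * K * (d / e) = C * (2 * d) * K / e by ring.
by rewrite ler_pM2r ?invr_gt0 // ler_pM2r // ler_pM2l.
Qed.

Lemma tree_assouad_dim_le : (assouad_dim E <= alpha%:E)%E.
Proof.
apply: (@assouad_dim_le _ _ (4 * (2 * C * K) `^ alpha + 1)) tree_covering_number_le.
by rewrite ltr_wpDl // mulr_ge0 // powR_ge0.
Qed.

(** All the gaps between two gaps of a subtree belong to the subtree, so that its total
    length bounds the distance. *)
Lemma subtree_spread i0 i j : prefix (nu i0) (nu i) -> prefix (nu i0) (nu j) ->
  `|v i - v j| <= K * b i0.
Proof.
wlog ij : i j / v i <= v j => [hw|] pi pj.
  by case: (leP (v i) (v j)) => [|/ltW] h; [|rewrite distrC]; exact: hw.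
rewrite distrC ger0_norm ?subr_ge0 // (E_dist (v_E i) (v_E j) ij).
apply: le_trans (subtree_total_le i0); apply: sum_over_sub => // k /andP[h1 h2].
have ik : prec i k.
  case: (eqVneq i k) => [e|/(tree_prec_total nu)/orP[//|/v_le_u h3]].
    by move: h1; rewrite e leNgt u_lt_v.
  have := le_lt_trans h1 (lt_le_trans (u_lt_v k) h3).
  by rewrite ltNge ltW //; exact: u_lt_v.
case: (eqVneq k j) => [->//|/(tree_prec_total nu)/orP[kj|/v_le_u h3]].
  exact: subtree_convex ik kj.
by have := le_lt_trans h3 (lt_le_trans (u_lt_v k) h2); rewrite ltxx.
Qed.

End TreeDimension.

(** * Central Cantor sets *)

Section Cantor.
Variables (R : realType) (r : nat -> R).
Hypothesis hr : forall j, (1 <= j)%N -> 0 < r j < 1 / 2.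

Definition step_length (n : nat) : R := \prod_(1 <= j < n.+1) r j.
Definition level_gap (n : nat) : R := step_length n * (1 - 2 * r n.+1).

Local Notation P := step_length.
Local Notation A := level_gap.

Lemma gap_seqE i : gap_seq r i = A (trunc_log 2 i).
Proof. by []. Qed.

Lemma gap_seq_level n i : (2 ^ n <= i < 2 ^ n.+1)%N -> gap_seq r i = A n.
Proof. by move=> h; rewrite gap_seqE (trunc_log_eq _ h). Qed.

Lemma step_length0 : P 0 = 1.
Proof. by rewrite /P big_geq. Qed.

Lemma step_lengthS n : P n.+1 = P n * r n.+1.
Proof. by rewrite /P big_nat_recr. Qed.

Lemma step_length_gt0 n : 0 < P n.
Proof.
elim: n => [|n IH]; first by rewrite step_length0.
by rewrite step_lengthS mulr_gt0 //; case/andP: (hr (ltn0Sn n)).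
Qed.

Lemma level_gapE n : A n = P n - 2 * P n.+1.
Proof. by rewrite /A step_lengthS; ring. Qed.

Lemma level_gap_gt0 n : 0 < A n.
Proof.
rewrite mulr_gt0 ?step_length_gt0 //; have /andP[_ h] := hr (ltn0Sn n).
lra.
Qed.

Lemma step_length_half n : 2 * P n.+1 <= P n.
Proof. by have := level_gap_gt0 n; rewrite level_gapE; lra. Qed.

Lemma step_length_anti m n : P (n + m) <= P n.
Proof.
elim: m => [|m IH]; first by rewrite addn0.
rewrite addnS; apply: le_trans IH; have := step_length_half (n + m).
by have := step_length_gt0 (n + m).+1; lra.
Qed.

Lemma level_gap_le n : A n <= P n.
Proof. by rewrite level_gapE; have := step_length_gt0 n.+1; lra. Qed.

Lemma step_length_lt (e : R) : 0 < e -> exists n0, forall n, (n0 <= n)%N -> P n < e.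
Proof.
move=> e0; exists (Num.truncn e^-1).+1 => n hn.
have h : 2 ^+ n * P n <= 1.
  elim: n {hn} => [|n IH]; first by rewrite step_length0 mulr1.
  apply: le_trans IH; rewrite exprSr -mulrA ler_wpM2l ?exprn_ge0 //.
  exact: step_length_half.
have h2 : e^-1 < 2 ^+ n.
  apply: lt_le_trans (truncnS_gt _) _; rewrite -natrX ler_nat.
  by apply: leq_trans hn _; rewrite ltnW // ltn_expl.
rewrite -(@ltr_pM2l _ (2 ^+ n)) ?exprn_gt0 //; apply: le_lt_trans h _.
by move: h2; rewrite -(ltr_pM2r e0) mulVf ?gt_eqF.
Qed.

Lemma level_gap_lt (e : R) : 0 < e -> exists n0, forall n, (n0 <= n)%N -> A n < e.
Proof.
move=> /step_length_lt[n0 h]; exists n0 => n /h; exact: le_lt_trans (level_gap_le n).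
Qed.

(** Step n leaves 2^n intervals, of total length 1 minus the gaps removed so far. *)
Lemma gap_seq_sum n : \sum_(1 <= i < 2 ^ n) gap_seq r i = 1 - 2 ^+ n * P n.
Proof.
elim: n => [|n IH]; first by rewrite big_geq // step_length0 mulr1 subrr.
rewrite (@big_cat_nat _ _ _ (2 ^ n)%N) ?expn_gt0 ?leq_pexp2l //= IH.
rewrite (eq_big_nat _ _ (F2 := fun=> A n)); last first.
  by move=> i /gap_seq_level.
rewrite sumr_const_nat expnS mul2n -addnn addnK -[A n *+ _]mulr_natr natrX level_gapE exprS.
ring.
Qed.

Lemma gap_seq_cvg : cvgn (fun n => \sum_(i < n) gap_seq r i.+1).
Proof.
have a0 i : 0 < gap_seq r i by exact: level_gap_gt0.
apply: nondecreasing_is_cvgn.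
  exact: (@partial_sum_homo _ (fun i => gap_seq r i.+1) (fun i => a0 i.+1) xpredT).
exists 1 => _ [n _ <-].
apply: (@le_trans _ _ (\sum_(1 <= i < 2 ^ n) gap_seq r i)); last first.
  by rewrite gap_seq_sum gerBl mulr_ge0 ?exprn_ge0 // ltW // step_length_gt0.
rewrite (_ : \sum_(i < n) _ = \sum_(1 <= i < n.+1) gap_seq r i); last first.
  by rewrite big_add1 big_mkord.
rewrite [leRHS](@big_cat_nat _ _ _ n.+1) //=; last exact: ltn_expl.
by rewrite lerDl sumr_ge0 // => i _; exact: ltW.
Qed.

(** The word w of length m lists the choices (false for left, true for right) made from
    step n to step n+m; left_end is the resulting displacement of the left end point. *)
Fixpoint left_end (n : nat) (w : seq bool) : R :=
  if w is c :: w' then (if c then P n - P n.+1 else 0) + left_end n.+1 w' else 0.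

Lemma left_end_ge0 n w : 0 <= left_end n w.
Proof.
elim: w n => //= c w IH n; rewrite addr_ge0 //; case: c => //.
by have := step_length_half n; have := step_length_gt0 n.+1; lra.
Qed.

Lemma left_end_le n w : left_end n w <= P n - P (n + size w).
Proof.
elim: w n => [|c w IH] n /=; first by rewrite addn0 subrr.
have := IH n.+1; rewrite addSnnS; case: c; first by lra.
have := step_length_half n; have := step_length_gt0 n.+1; lra.
Qed.

Lemma left_end_cat n w z : left_end n (w ++ z) = left_end n w + left_end (n + size w) z.
Proof.
elim: w n => [|c w IH] n /=; first by rewrite addn0 add0r.
by rewrite IH addrA addSnnS.
Qed.

Lemma left_end_nseq n k : left_end n (nseq k false) = 0.
Proof. by elim: k n => //= k IH n; rewrite IH addr0. Qed.

(** At the first step where the choices differ, the two end points are separated by the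
    gap removed and one more interval; the later steps cannot make up for it. *)
Lemma left_end_sep n w z : size w = size z -> w != z ->
  P (n + size w) <= `|left_end n w - left_end n z|.
Proof.
elim: w z n => [|c w IH] [|d z] n //= [sz].
rewrite eqseq_cons negb_and; have [<-|] := eqVneq c d => /= [|cd _].
  rewrite opprD addrACA subrr add0r -addSnnS; exact: IH.
have := left_end_ge0 n.+1 w; have := left_end_le n.+1 z.
have := left_end_ge0 n.+1 z; have := left_end_le n.+1 w.
rewrite sz addSnnS; have := step_length_half n; have := step_length_gt0 n.+1.
case: c d cd => [] [] // _ *; last rewrite distrC; apply: le_trans (ler_norm _); lra.
Qed.

Lemma cantor_step_word w :
  (left_end 0 w, left_end 0 w + P (size w)) \in cantor_step r (size w).
Proof.
elim/last_ind: w => [|w c IH]; first by rewrite /= step_length0 add0r inE.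
rewrite size_rcons -cats1 left_end_cat add0n /= addr0.
apply/flattenP; eexists; first by apply/mapP; eexists; first exact: IH.
have -> : left_end 0 w + P (size w) - left_end 0 w = P (size w) by ring.
rewrite [r _ * _]mulrC -step_lengthS !inE /= !xpair_eqE.
case: c; apply/orP; [right|left]; rewrite ?addr0 ?eqxx //.
by apply/andP; split; apply/eqP; ring.
Qed.

Lemma left_end_central_cantor w : central_cantor r (left_end 0 w).
Proof.
(* Choosing left again and again keeps the same left end point. *)
move=> k _ /=; set z := w ++ nseq k false.
have -> : left_end 0 w = left_end 0 z.
  by rewrite /z left_end_cat left_end_nseq addr0.
have szk : size (take k z) = k.
  by rewrite size_takel // /z size_cat size_nseq leq_addl.
exists (left_end 0 (take k z), left_end 0 (take k z) + P k).
  by have := cantor_step_word (take k z); rewrite szk.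
have -> : left_end 0 z = left_end 0 (take k z) + left_end k (drop k z).
  by rewrite -{1}(cat_take_drop k z) left_end_cat add0n szk.
rewrite /= lerDl left_end_ge0 lerD2l /=; apply: le_trans (left_end_le _ _) _.
by rewrite gerBl ltW // step_length_gt0.
Qed.

End Cantor.

(** * Decay of the gaps of a central Cantor set *)

Section CantorDecay.
Variables (R : realType) (r : nat -> R).
Hypothesis hr : forall j, (1 <= j)%N -> 0 < r j < 1 / 2.
Hypothesis hdbl : doubling (gap_seq r).
Local Notation P := (step_length r).
Local Notation A := (level_gap r).

Lemma level_gapS n : A n.+1 <= A n.
Proof.
have [a_dec _] := hdbl.
have p0 : (0 < 2 ^ n)%N by rewrite expn_gt0.
have := a_dec (2 ^ n.+1).-1; rewrite prednK ?expn_gt0 //.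
rewrite (@gap_seq_level _ r n.+1); last by rewrite leqnn ltn_exp2l // ltnSn.
rewrite (@gap_seq_level _ r n); last by rewrite expnS; lia.
by apply; rewrite expnS; lia.
Qed.

Lemma level_gap_anti n m : (n <= m)%N -> A m <= A n.
Proof.
move=> /subnK <-; elim: (m - n)%N => [|k IH]; first by [].
by apply: le_trans IH; rewrite addSn; exact: level_gapS.
Qed.

Lemma level_gap_doubling : exists2 tau, 1 <= tau & forall n, A n <= tau * A n.+1.
Proof.
have [_ [tau ht]] := hdbl.
have h n : A n <= tau * A n.+1.
  have := ht (2 ^ n)%N; rewrite -expnS !gap_seqE !trunc_expnK //.
  by apply; rewrite expn_gt0.
exists tau => //; have := h 0%N; have := level_gapS 0; have := level_gap_gt0 hr 1.
by move=> h1 h2 h3; rewrite -(ler_pM2r h1) mul1r (le_trans h2).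
Qed.

(** The leftmost interval of step n contains 2^m intervals of step n+m, whose left end points
    belong to the Cantor set and are separated by the length of such an interval. *)
Lemma central_cantor_covering n m :
  ((2 ^+ m)%:E <= covering_number (P (n + m) / 3)
     (closed_ball (0%R : R) (P n) `&` central_cantor r))%E.
Proof.
have Pm := step_length_gt0 hr (n + m); have Pn := step_length_gt0 hr n.
have -> : (2 : R) ^+ m = #|{: m.-tuple bool}|%:R.
  by rewrite card_tuple card_bool natrX.
apply: (@separated_covering_number _ _ (fun w : m.-tuple bool => left_end r n w)).
- lra.
- move=> w; split.
    apply/in_closed_ball => //; rewrite sub0r normrN ger0_norm ?left_end_ge0 //.
    by have := left_end_le hr n w; rewrite size_tuple; lra.
  have := left_end_central_cantor hr (nseq n false ++ w).
  by rewrite left_end_cat left_end_nseq add0r size_nseq.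
- move=> w z wz; apply: (@lt_le_trans _ _ (P (n + m))); first by lra.
  by have := @left_end_sep _ _ hr n w z; rewrite !size_tuple; exact.
Qed.

Lemma step_length_decay alpha : 0 < alpha ->
  (assouad_dim (central_cantor r) < alpha%:E)%E ->
  exists D : R, 0 < D /\ exists n0, forall n m, (n0 <= n)%N ->
    P (n + m) <= D * P n * dim_ratio alpha ^+ m.
Proof.
move=> a0 /ereal_inf_lt[_ [beta [c [rho [c0 rho0 hc]]] <-]]; rewrite lte_fin => ba.
exists (3 * c `^ alpha^-1); split; first by rewrite mulr_gt0 // powR_gt0.
have [n0 hn0] := step_length_lt hr rho0; exists n0 => n m nn0.
have Pm := step_length_gt0 hr (n + m); have Pn := step_length_gt0 hr n.
have Pnm := step_length_anti hr m n.
set X := P n / (P (n + m) / 3).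
have X1 : 1 <= X by rewrite /X ler_pdivlMr; lra.
have X0 : 0 < X by exact: lt_le_trans X1.
have b1 : 2 ^+ m <= c * X `^ alpha.
  apply: (@le_trans _ _ (c * X `^ beta)); last first.
    by rewrite ler_pM2l // ler_powR // ltW.
  rewrite -lee_fin; apply: le_trans (central_cantor_covering n m) _.
  apply: le_trans (hc _ _ _ _ (hn0 _ nn0)); [|lra|lra].
  apply: ereal_sup_ubound; exists 0 => //.
  exact: (left_end_central_cantor hr [::]).
rewrite dim_ratioX -mulrA mulrA ler_pdivlMr ?powR_gt0 ?exprn_gt0 //.
have -> : 3 * c `^ alpha^-1 * P n = c `^ alpha^-1 * X * P (n + m).
  by rewrite /X; field; rewrite gt_eqF.
rewrite mulrC ler_pM2r //.
apply: (@le_trans _ _ ((c * X `^ alpha) `^ alpha^-1)).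
  apply: ge0_ler_powR => //; rewrite ?nnegrE ?exprn_ge0 // ?invr_ge0; first exact: ltW.
  by rewrite mulr_ge0 ?powR_ge0 // ltW.
rewrite powRM ?powR_ge0 ?(ltW c0) // -powRrM mulfV ?gt_eqF // powRr1 //.
exact: ltW.
Qed.

(** When the dimension is less than alpha < 1, the steps shrink faster than by a factor 2,
    so that each step is comparable to its gap and the decay of the steps passes to
    the gaps. *)
Lemma level_gap_decay alpha : 0 < alpha -> alpha < 1 ->
  (assouad_dim (central_cantor r) < alpha%:E)%E ->
  exists2 D : R, 0 < D & forall n m, A (n + m) <= D * A n * dim_ratio alpha ^+ m.
Proof.
move=> a0 a1 /(step_length_decay a0)[D [D0 [n0 hD]]].
set q := dim_ratio alpha in hD *.
have q0 : 0 < q by exact: dim_ratio_gt0.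
have q12 : q < 1 / 2 by exact: dim_ratio_lt12.
(* After h steps at most half of the length of an interval is left: here 2 q < 1 matters. *)
have [h hh] : exists h, D * (2 * q) ^+ h <= 1 / 2.
  have : (fun h => D * (2 * q) ^+ h) @ \oo --> D * 0.
    apply: cvgMr; apply: cvg_expr; rewrite ger0_norm; last by rewrite mulr_ge0 // ltW.
    lra.
  rewrite mulr0 => /cvgrPdist_lt/(_ (1 / 2)); case; first by lra.
  move=> h _ /(_ h (leqnn _)) /=; rewrite sub0r normrN => /ltW hh; exists h.
  exact: le_trans (ler_norm _) hh.
(* Of an interval of step n, k more steps remove at most 2^k - 1 gaps, none larger than A n. *)
have tel n k : P n <= (2 ^+ k - 1) * A n + 2 ^+ k * P (n + k).
  elim: k => [|k IH]; first by rewrite expr0 subrr mul0r add0r mul1r addn0.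
  apply: le_trans IH _; rewrite addnS.
  have := level_gapE r (n + k); have := level_gap_anti (leq_addr k n).
  set a := A (n + k); set a' := A n; set p := P (n + k); set p' := P _ => e1 e2.
  have -> : p = a + 2 * p' by rewrite e2; ring.
  have : (0 : R) < 2 ^+ k by rewrite exprn_gt0.
  rewrite exprS; nra.
have PA n : (n0 <= n)%N -> P n <= 2 * 2 ^+ h * A n.
  move=> nn0; have := tel n h; have := hD n h nn0.
  have := level_gap_gt0 hr n; have := step_length_gt0 hr n.
  have p0 : (0 : R) < 2 ^+ h by rewrite exprn_gt0.
  move: hh; rewrite exprMn => hh Pn An h1 h2.
  have h3 := ler_wpM2l (ltW p0) h1.
  have h4 := ler_wpM2l (ltW Pn) hh.
  have -> : P n = 2 * (P n - P n * (1 / 2)) by field.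
  have : P n * (D * (2 ^+ h * q ^+ h)) = 2 ^+ h * (D * P n * q ^+ h) by ring.
  lra.
set D' := D * (2 * 2 ^+ h).
have D'0 : 0 < D' by rewrite !mulr_gt0 ?exprn_gt0.
have big n m : (n0 <= n)%N -> A (n + m) <= D' * A n * q ^+ m.
  move=> nn0; apply: le_trans (level_gap_le hr _) _.
  apply: le_trans (hD _ _ nn0) _; rewrite ler_pM2r ?exprn_gt0 // /D' -mulrA.
  by rewrite ler_pM2l //; exact: PA.
(* The finitely many levels below n0 only cost a factor q^-n0. *)
have q1 : q <= 1 by lra.
exists ((D' + 1) * q ^- n0); first by rewrite mulr_gt0 ?invr_gt0 ?exprn_gt0 // ltr_wpDl // ltW.
move=> n m; have An := level_gap_gt0 hr n.
have qn0 : 0 < q ^+ n0 by rewrite exprn_gt0.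
have -> : (D' + 1) * q ^- n0 * A n * q ^+ m = (D' + 1) * A n * (q ^+ m / q ^+ n0) by ring.
case: (leqP n0 n) => nn0.
  apply: le_trans (big _ _ nn0) _; apply: ler_pM.
  - by rewrite mulr_ge0 // ltW.
  - by rewrite exprn_ge0 // ltW.
  - by rewrite ler_pM2r // lerDl.
  - by rewrite ler_peMr ?exprn_ge0 ?(ltW q0) // invf_ge1 // exprn_ile1 // ltW.
case: (leqP n0 (n + m)) => nm.
  have -> : (n + m = n0 + (n + m - n0))%N by rewrite subnKC.
  apply: le_trans (big _ _ (leqnn _)) _; apply: ler_pM.
  - by rewrite mulr_ge0 ?ltW // level_gap_gt0.
  - by rewrite exprn_ge0 // ltW.
  - apply: ler_pM; first exact: ltW.
    + exact: ltW (level_gap_gt0 hr _).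
    + by rewrite lerDl.
    + by apply: level_gap_anti; exact: ltnW.
  - rewrite ler_pdivlMr // -exprD subnK // ler_wiXn2l // ?(ltW q0) //.
    exact: leq_addl.
apply: le_trans (level_gap_anti (leq_addr m n)) _.
rewrite -[leLHS]mulr1; apply: ler_pM => //; first exact: ltW.
  by rewrite ler_peMl ?(ltW An) // lerDr ltW.
rewrite ler_pdivlMr // mul1r ler_wiXn2l // ?(ltW q0) //.
by apply: leq_trans (ltnW nm); exact: leq_addl.
Qed.

End CantorDecay.

(** * Placing the gaps in a tree *)

(** The binary expansion below the leading digit, least significant digit first: the words
    of length n are in bijection with the integers of level n. *)
Fixpoint enc (w : seq bool) : nat := if w is c :: w' then (enc w').*2 + c else 1.

Lemma enc_bounds w : (2 ^ size w <= enc w < 2 ^ (size w).+1)%N.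
Proof.
elim: w => [|c w /andP[h1 h2]] //=; rewrite !expnS -mul2n in h2 *.
by case: c; lia.
Qed.

Lemma enc_inj : injective enc.
Proof.
have enc_gt0 w : (0 < enc w)%N.
  by have /andP[h _] := enc_bounds w; apply: leq_trans h; rewrite expn_gt0.
elim=> [|c w IH] [|d z] //= e.
- by exfalso; have := enc_gt0 z; case: d e; lia.
- by exfalso; have := enc_gt0 w; case: c e; lia.
- have := congr1 odd e; rewrite !oddD !odd_double !oddb => /= cd.
  by rewrite cd in e *; rewrite (IH z) //; lia.
Qed.

Lemma enc_surj m : (0 < m)%N -> exists w, enc w = m.
Proof.
elim/ltn_ind: m => m IH m0; have [m1|m1] := leqP m 1; first by exists [::]; rewrite /=; lia.
have [w ew] := IH m./2 ltac:(lia) ltac:(lia).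
by exists (odd m :: w); rewrite /= ew addnC odd_double_half.
Qed.

(** Depths are grouped into blocks: block p consists of the depths d with
    2^p <= d + 1 < 2^(p+1), so that the blocks get longer and longer. *)
Definition block_start (d : nat) : nat := 2 ^ trunc_log 2 d.+1.

Lemma block_start_bounds d : (block_start d <= d.+1 < 2 * block_start d)%N.
Proof. by rewrite /block_start -expnS; apply: trunc_log_bounds. Qed.

Lemma block_start_mono d d' : (d <= d')%N ->
  block_start d = block_start d' \/ (2 * block_start d <= block_start d')%N.
Proof.
move=> dd; have : (trunc_log 2 d.+1 <= trunc_log 2 d'.+1)%N by apply: leq_trunc_log.
rewrite /block_start leq_eqVlt => /orP[/eqP->|h]; [by left|right].
by rewrite -expnS leq_exp2l.
Qed.

Lemma block_startE p d : (2 ^ p <= d.+1 < 2 ^ p.+1)%N -> block_start d = (2 ^ p)%N.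
Proof. by move=> h; rewrite /block_start (trunc_log_eq _ h). Qed.

(** The words of the comb: before its block, a word only has false letters; so each block
    is a full binary tree hanging from the leftmost branch. *)
Definition comb (z : seq bool) : Prop :=
  forall x, (x.+1 < block_start (size z))%N -> nth false z x = false.

Lemma comb_nil : comb [::].
Proof. by move=> x; rewrite nth_nil. Qed.

Lemma comb_prefix p z : prefix p z -> comb z -> comb p.
Proof.
move=> /prefixP[t ->] cz x hx; have [px|px] := leqP (size p) x; first by rewrite nth_default.
have := cz x; rewrite nth_cat px; apply; apply: leq_trans hx _.
have : (size p <= size (p ++ t))%N by rewrite size_cat leq_addr.
by case/block_start_mono => [->//|]; apply: leq_trans; exact: leq_pmull.
Qed.

Lemma comb_head w : ~ comb (true :: w).
Proof.
move=> /(_ 0%N) /=; have := block_start_bounds (size w).+1.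
by move=> /andP[_ h] /(_ ltac:(lia)).
Qed.

Section Placement.
Variable lev : nat -> nat.
Hypothesis lev_ge : forall d, (4 * block_start d <= lev d)%N.

(** A gap of level lev d is used at the node z of depth d of the comb; numbering by the
    code of z makes these gaps different, and all of even index. *)
Definition comb_index (z : seq bool) : nat := (2 ^ lev (size z) + 2 * enc z)%N.

Lemma comb_index_level z : trunc_log 2 (comb_index z).+1 = lev (size z).
Proof.
apply: trunc_log_eq => //; rewrite /comb_index.
have /andP[_ h1] := enc_bounds z; have := lev_ge (size z).
have := block_start_bounds (size z) => /andP[_ h2] h3.
have h4 : (2 ^ (size z).+2 <= 2 ^ lev (size z))%N by rewrite leq_exp2l //; lia.
by move: h1 h4; rewrite !expnS; lia.
Qed.

Lemma comb_index_inj : injective comb_index.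
Proof.
move=> z z' e; have := congr1 (fun m => trunc_log 2 m.+1) e.
rewrite !comb_index_level => el; apply: enc_inj; move: e.
by rewrite /comb_index el; lia.
Qed.

Lemma comb_index_even z : odd (comb_index z) = false.
Proof.
rewrite oddD oddM /= addbF oddX orbF.
by have := lev_ge (size z); have := block_start_bounds (size z); case: (lev _) => //; lia.
Qed.

(** The gaps that are not used in the comb are placed in the right subtree of the root, in
    their usual order; gap i goes to the node coded by i./2 + 1, so that the gaps of odd index
    suffice to occupy all nodes. *)
Definition placement (i : nat) : seq bool :=
  xget (true :: xget [::] [set w | enc w = i./2.+1]) [set z | comb z /\ comb_index z = i].

Lemma placement_comb z : comb z -> placement (comb_index z) = z.
Proof.
move=> cz; rewrite /placement.
apply: xget_unique => // y [_ /comb_index_inj]; exact.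
Qed.

Lemma placementP i : (comb (placement i) /\ comb_index (placement i) = i) \/
  exists2 w, placement i = true :: w & enc w = i./2.+1.
Proof.
have [[z [cz <-]]|none] := pselect (exists z, comb z /\ comb_index z = i).
  by left; rewrite placement_comb.
right; exists (xget [::] [set w | enc w = i./2.+1]).
  by rewrite {1}/placement xgetPN // => z h; apply: none; exists z.
exact: (xgetPex [::] (enc_surj (ltn0Sn i./2))).
Qed.

Lemma placement_inj : injective (fun i => (placement i, odd i)).
Proof.
move=> i j [eP eo].
case: (placementP i) => [[ci hi]|[w hi ei]]; case: (placementP j) => [[cj hj]|[w' hj ej]].
- by rewrite -hi -hj eP.
- by case: (@comb_head w'); rewrite -hj -eP.
- by case: (@comb_head w); rewrite -hi eP.
- move: eP; rewrite hi hj => -[ww]; move: ej; rewrite -ww ei => -[e].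
  by rewrite -(odd_double_half i) -(odd_double_half j) eo e.
Qed.

Lemma placement_prefix i p : prefix p (placement i) -> exists j, placement j = p.
Proof.
case: (placementP i) => [[ci _] /comb_prefix/(_ ci) cp|[w -> _]].
  by exists (comb_index p); exact: placement_comb.
case: p => [|c p]; first by move=> _; exists (comb_index [::]); exact: (placement_comb comb_nil).
rewrite prefix_cons => /andP[/eqP -> _].
have p0 : (0 < enc p)%N.
  by have /andP[h _] := enc_bounds p; apply: leq_trans h; rewrite expn_gt0.
exists (enc p).-1.*2.+1; case: (placementP (enc p).-1.*2.+1) => [[_ h]|[z -> ez]].
  by have := comb_index_even (placement (enc p).-1.*2.+1); rewrite h /= odd_double.
by congr (_ :: _); apply: enc_inj; rewrite ez; lia.
Qed.

Lemma placement_right_level i w : enc w = i./2.+1 ->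
  (size w <= trunc_log 2 i.+1 <= (size w).+1)%N.
Proof.
move=> e; have := enc_bounds w; rewrite e => /andP[h1 h2]; apply/andP; split.
  by apply: trunc_log_max => //; lia.
rewrite -ltnS -(@ltn_exp2l 2) //; apply: (@leq_ltn_trans i.+1).
  exact: trunc_logP.
by move: h2; rewrite !expnS; lia.
Qed.

End Placement.

(** * Arrangements of intermediate dimension *)

Lemma block_exponent_same m d d' : (m <= d.+1)%N -> (d <= d')%N ->
  (d'.+1 - m = (d.+1 - m) + (d' - d))%N.
Proof. by lia. Qed.

Lemma block_exponent_next m m' d d' : (d.+1 < 2 * m)%N -> (m' <= d'.+1)%N ->
  (2 * m <= m')%N -> (d <= d')%N ->
  (2 * (d.+1 - m) + (d' - d) <= 4 * m' - 4 * m + (d'.+1 - m'))%N.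
Proof. by lia. Qed.

Section Intermediate.
Variables (R : realType) (A : nat -> R) (tau s : R) (lev : nat -> nat).
Hypothesis A_gt0 : forall n, 0 < A n.
Hypothesis A_anti : forall n m, (n <= m)%N -> A m <= A n.
Hypothesis A_lt : forall e, 0 < e -> exists n0, forall n, (n0 <= n)%N -> A n < e.
Hypothesis tau_ge1 : 1 <= tau.
Hypothesis A_doubling : forall n, A n <= tau * A n.+1.
Hypothesis s_gt0 : 0 < s.
Hypothesis s_lt1 : s < 1.
Hypothesis A_decay : forall alpha, s < alpha -> alpha < 1 ->
  exists2 D, 0 < D & forall n m, A (n + m) <= D * A n * dim_ratio alpha ^+ m.

Local Notation M := block_start.
Local Notation q := (dim_ratio s).

(** At depth d of the comb sits a gap of level lev d, the size of which follows a geometric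
    sequence of ratio q from the first depth of each block on. The sequence is restarted at
    level 4 M in the block starting at M: high enough for enough gaps to be available, and for
    the first gaps of the successive blocks to be very different. *)
Hypothesis lev_ge : forall d, (4 * M d <= lev d)%N.
Hypothesis lev_le : forall d, A (lev d) <= A (4 * M d) * q ^+ (d.+1 - M d).
Hypothesis lev_lb : forall d, A (4 * M d) * q ^+ (d.+1 - M d) <= tau * A (lev d).

Let b (i : nat) : R := A (trunc_log 2 i.+1).
Hypothesis b_cvg : cvgn (fun n => \sum_(i < n) b i).
Let nu := placement lev.
Let E := arrangement b (tree_prec nu).
Let nu_inj : injective (fun i => (nu i, odd i)) := placement_inj lev_ge.
Let nu_prefix : forall i p, prefix p (nu i) -> exists j, nu j = p := placement_prefix lev_ge.
Let b_gt0 i : 0 < b i. Proof. exact: A_gt0. Qed.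
Let tau_gt0 : 0 < tau. Proof. exact: lt_le_trans tau_ge1. Qed.

Lemma comb_gap z : b (comb_index lev z) = A (lev (size z)).
Proof. by rewrite /b (comb_index_level lev_ge). Qed.

Lemma right_gap_le i w : enc w = i./2.+1 -> b i <= A (size w).
Proof. by move=> /placement_right_level/andP[h _]; exact: A_anti. Qed.

Lemma right_gap_ge i w : enc w = i./2.+1 -> A (size w) <= tau * b i.
Proof.
move=> /placement_right_level/andP[_ h]; apply: le_trans (A_doubling _) _.
by rewrite ler_pM2l //; exact: A_anti.
Qed.

(** Inside a block both gaps have prescribed sizes. From a block starting at M to a later one
    starting at M', the first gaps 4M and 4M' are at least 2M' levels apart in the Cantor
    set: M' of these levels pay for the difference of depth, and as p^2 <= q the others make
    up for the decay of ratio q, faster than p, inside the first block. *)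
Lemma comb_decay (D p : R) d d' : 0 < D -> 0 < p -> p <= 1 -> q <= p -> p ^+ 2 <= q ->
  (forall n m, A (n + m) <= D * A n * p ^+ m) -> (d <= d')%N ->
  A (lev d') <= (D * tau + tau) * A (lev d) * p ^+ (d' - d).
Proof.
move=> D0 p0 p1 qp p2q hD dd.
have q0 : 0 < q by exact: dim_ratio_gt0.
have Md := block_start_bounds d; have Md' := block_start_bounds d'.
have Ad := A_gt0 (lev d).
have h0 : 0 <= A (lev d) * p ^+ (d' - d) by rewrite mulr_ge0 ?exprn_ge0 // ltW.
case: (block_start_mono dd) => MM.
  apply: (@le_trans _ _ (tau * A (lev d) * p ^+ (d' - d))); last first.
    rewrite -!mulrA; apply: ler_wpM2r => //; by rewrite lerDr mulr_ge0 // ltW.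
  apply: le_trans (lev_le d') _; rewrite -MM.
  rewrite (block_exponent_same _ dd); last by case/andP: Md.
  rewrite exprD mulrA; apply: ler_pM.
  - by rewrite mulr_ge0 ?exprn_ge0 // ltW.
  - by rewrite exprn_ge0 // ltW.
  - exact: lev_lb.
  - by rewrite lerXn2r // nnegrE ltW.
apply: (@le_trans _ _ (D * tau * A (lev d) * p ^+ (d' - d))); last first.
  rewrite -!mulrA [X in _ <= X]mulrDl mulrA; rewrite lerDl.
  by rewrite mulr_ge0 // ltW.
apply: le_trans (lev_le d') _.
apply: (@le_trans _ _ (A (4 * M d') * p ^+ (d'.+1 - M d'))).
  by rewrite ler_pM2l // lerXn2r // nnegrE ltW.
rewrite -(subnKC (_ : 4 * M d <= 4 * M d')%N); last first.
  by rewrite leq_mul2l /= (leq_trans _ MM) // leq_pmull.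
apply: (@le_trans _ _ (D * A (4 * M d) * p ^+ (4 * M d' - 4 * M d) * p ^+ (d'.+1 - M d'))).
  by rewrite ler_pM2r ?exprn_gt0.
rewrite -mulrA -exprD.
apply: (@le_trans _ _ (D * A (4 * M d) * (q ^+ (d.+1 - M d) * p ^+ (d' - d)))).
  rewrite ler_pM2l ?mulr_gt0 //.
  apply: (@le_trans _ _ (p ^+ (2 * (d.+1 - M d)) * p ^+ (d' - d))).
    rewrite -exprD; apply: ler_wiXn2l => //; first exact: ltW.
    by apply: block_exponent_next => //; case/andP: Md Md' => // _ _ /andP[].
  rewrite ler_pM2r ?exprn_gt0 // exprM lerXn2r // nnegrE ?exprn_ge0 // ltW //.
rewrite mulrA; apply: ler_wpM2r; first by rewrite exprn_ge0 // ltW.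
by rewrite -!mulrA ler_pM2l.
Qed.

(** The hypotheses on alpha give p^2 <= q <= p for the ratio p of alpha. The root is
    the only node with descendants both in the comb and in the right subtree. *)
Lemma placement_decay alpha : s < alpha -> alpha < 1 -> alpha <= 2 * s ->
  exists C, forall i j, prefix (nu i) (nu j) ->
    b j <= C * b i * dim_ratio alpha ^+ (size (nu j) - size (nu i)).
Proof.
move=> sa a1 a2; have a0 : 0 < alpha by exact: lt_trans sa.
have [D D0 hD] := A_decay sa a1; set p := dim_ratio alpha in hD *.
have p0 : 0 < p by exact: dim_ratio_gt0.
have p1 : p <= 1 by have := dim_ratio_lt12 a0 a1; rewrite -/p; lra.
have qp : q <= p by apply: dim_ratio_le; rewrite // ltW.
have p2q : p ^+ 2 <= q.
  rewrite /p /dim_ratio -powR_mulrn ?powR_ge0 // -powRrM ler_powR //; first by lra.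
  by rewrite mulNr lerN2 ler_pdivlMl // ler_pdivrMr.
have AL0 := A_gt0 (lev 0).
set C1 := D * tau + tau; set C2 := D * A 0 / (A (lev 0) * p).
have C1_ge0 : 0 <= C1 by rewrite addr_ge0 ?mulr_ge0 // ltW.
have C2_ge0 : 0 <= C2 by rewrite divr_ge0 ?mulr_ge0 // ltW.
exists (C1 + C2) => i j.
have bi0 := b_gt0 i.
suff h : prefix (nu i) (nu j) ->
    b j <= C1 * b i * p ^+ (size (nu j) - size (nu i)) \/
    b j <= C2 * b i * p ^+ (size (nu j) - size (nu i)).
  case/h => h'; apply: le_trans h' _; rewrite ler_pM2r ?exprn_gt0 // ler_pM2r //.
    by rewrite lerDl.
  by rewrite lerDr.
case: (placementP lev_ge i) => [[ci hi]|[w hi ei]];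
  case: (placementP lev_ge j) => [[cj hj]|[w' hj ej]].
- rewrite -/nu in ci hi cj hj *; move=> pij; left; rewrite -{1}hi -{1}hj !comb_gap.
  by apply: (comb_decay D0) => //; exact: size_prefix pij.
- rewrite -/nu in ci hi hj *; rewrite hj; case e : (nu i) => [|c w].
    move=> _; right; rewrite -hi e comb_gap /= subn0.
    apply: le_trans (right_gap_le ej) _; rewrite -[size w']add0n.
    apply: le_trans (hD _ _) _; rewrite add0n exprS /C2 le_eqVlt; apply/orP; left.
    by apply/eqP; field; rewrite !gt_eqF.
  rewrite prefix_cons => /andP[/eqP cE _]; move: ci; rewrite e cE => /comb_head; by [].
- rewrite -/nu in hi cj hj *; rewrite hi; case e : (nu j) => [|c w''] //.
  rewrite prefix_cons => /andP[/eqP cE _]; move: cj; rewrite e -cE => /comb_head; by [].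
- rewrite -/nu in hi hj *; rewrite hi hj prefix_cons eqxx /= => pij; left; rewrite subSS.
  apply: le_trans (right_gap_le ej) _.
  rewrite -(subnKC (size_prefix pij)); apply: le_trans (hD _ _) _.
  rewrite addKn ler_pM2r ?exprn_gt0 //; apply: (@le_trans _ _ (D * (tau * b i))).
    by rewrite ler_pM2l // right_gap_ge.
  by rewrite mulrA ler_pM2r // lerDl ltW.
Qed.

(** The Cantor set only provides a decay of exponents larger than s, hence the use of exponents
    tending to s; this also covers the case where s is its dimension. *)
Lemma admissible_exponent (e : R) : 0 < e ->
  exists alpha, [/\ s < alpha, alpha < 1, alpha <= 2 * s & alpha <= s + e].
Proof.
move=> e0; have s0 := s_gt0; have s1 := s_lt1; have h1 : s < s + e by lra.
have h2 : s < (s + 1) / 2 by lra.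
have h3 : s < 2 * s by lra.
have h4 : (s + 1) / 2 < 1 by lra.
exists (Num.min (s + e) (Num.min ((s + 1) / 2) (2 * s))).
by rewrite !lt_min !gt_min !ge_min !lexx h1 h2 h3 h4 !orbT.
Qed.

Lemma intermediate_dim_le : (assouad_dim E <= s%:E)%E.
Proof.
apply/lee_addgt0Pr => e e0; rewrite -EFinD.
have [alpha [sa a1 a2 ae]] := admissible_exponent e0.
have [C hC] := placement_decay sa a1 a2.
apply: (@le_trans _ _ alpha%:E); last by rewrite lee_fin.
exact: (tree_assouad_dim_le b_gt0 b_cvg nu_inj nu_prefix (lt_trans s_gt0 sa) a1 hC).
Qed.

(** In the block starting at 2^n = k + 1, the 2^k deepest gaps are smaller than the first one by
    a factor q^k = 2^(-k/s) and stand within a distance comparable to this first gap. *)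
Lemma intermediate_dim_ge : (s%:E <= assouad_dim E)%E.
Proof.
have [alpha [sa a1 a2 _]] := admissible_exponent ltr01.
have a0 := lt_trans s_gt0 sa.
have [C hC] := placement_decay sa a1 a2.
pose K := C * (2 / (1 - 2 * dim_ratio alpha)).
have K1 : 1 < K := subtree_constant_gt1 b_gt0 a0 a1 hC.
have spread := subtree_spread b_gt0 b_cvg nu_inj a0 a1 hC.
have vlt := gap_right_lt b_gt0 b_cvg (tree_precxx nu) (@tree_prec_trans nu)
  (@tree_prec_total nu).
have vE := gap_right_arrangement b_gt0 b_cvg (tree_precxx nu) (@tree_prec_trans nu)
  (@tree_prec_total nu).
set v := gap_right b (tree_prec nu) in spread vlt vE.
have K0 : 0 < K by exact: lt_trans K1.
have q0 : 0 < q by exact: dim_ratio_gt0.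
have q1 : q <= 1 by have := dim_ratio_lt12 s_gt0 s_lt1; lra.
apply: (@assouad_dim_ge _ _ _ (3 * tau * K)) => // rho k0 rho0.
have [n0 hn0] : exists n0, forall n, (n0 <= n)%N -> A n < rho / K.
  by apply: A_lt; rewrite divr_gt0.
have [n [k [nn0 nk0 Ek]]] : exists n k, [/\ (n0 <= n)%N, (k0 <= n)%N & (2 ^ n = k.+1)%N].
  exists (maxn n0 k0), (2 ^ maxn n0 k0).-1.
  by rewrite leq_maxl leq_maxr prednK // expn_gt0.
have nk : (n <= k)%N by rewrite -ltnS -Ek ltn_expl.
pose leaf (w : seq bool) := nseq k false ++ w.
have sz_leaf (w : k.-tuple bool) : size (leaf w) = (k + k)%N.
  by rewrite size_cat size_nseq size_tuple.
have Mroot : M k = k.+1 by rewrite (@block_startE n) // expnS Ek; clear; lia.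
have Mleaf : M (k + k) = k.+1 by rewrite (@block_startE n) // expnS Ek; clear; lia.
have c_root : comb (nseq k false).
  by move=> x; rewrite nth_nseq; case: ifP.
have c_leaf (w : k.-tuple bool) : comb (leaf w).
  by move=> x; rewrite sz_leaf Mleaf ltnS => h; rewrite nth_cat size_nseq h nth_nseq h.
pose root := comb_index lev (nseq k false).
pose idx (w : seq bool) := comb_index lev (leaf w).
have nu_root : nu root = nseq k false by exact: placement_comb.
have nu_leaf (w : k.-tuple bool) : nu (idx w) = leaf w by exact: placement_comb.
have below (w : k.-tuple bool) : prefix (nu root) (nu (idx w)).
  by rewrite nu_root nu_leaf prefix_prefix.
set a := A (4 * k.+1).
have a_gt0 : 0 < a by exact: A_gt0.
have b_root : b root <= a.
  rewrite /root comb_gap size_nseq; apply: le_trans (lev_le _) _.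
  by rewrite Mroot subnn expr0 mulr1.
have b_leaf (w : k.-tuple bool) : a * q ^+ k <= tau * b (idx w).
  rewrite /idx comb_gap sz_leaf; have := lev_lb (k + k); rewrite Mleaf.
  by rewrite (_ : ((k + k).+1 - k.+1 = k)%N) // subSS addnK.
have qk0 : 0 < q ^+ k by rewrite exprn_gt0.
have qk1 : q ^+ k <= 1 by rewrite exprn_ile1 // ltW.
pose e := a * q ^+ k / (3 * tau).
have e0 : 0 < e by rewrite divr_gt0 ?mulr_gt0.
pose w0 : k.-tuple bool := [tuple of nseq k false].
exists k, (K * a), e, (v (idx w0)); split => //.
- exact: leq_trans nk0 nk.
- rewrite /e ltr_pdivrMr ?mulr_gt0 //.
  have : a * q ^+ k <= a by rewrite ler_piMr // ltW.
  have : a < K * a by rewrite ltr_pMl.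
  have : K * a <= K * a * (3 * tau).
    apply: ler_peMr; first exact: mulr_ge0 (ltW K0) (ltW a_gt0).
    by have := tau_ge1; lra.
  by lra.
- rewrite mulrC -ltr_pdivlMr //; apply: hn0.
  by apply: leq_trans nn0 (leq_trans nk _); clear; lia.
split.
- rewrite /e -[_ `^ _]invrK -dim_ratioX le_eqVlt; apply/orP; left; apply/eqP.
  by field; rewrite !gt_eqF.
- exact: vE.
have -> : (2 : R) ^+ k = #|{: k.-tuple bool}|%:R.
  by rewrite card_tuple card_bool natrX.
apply: (@separated_covering_number _ _ (fun w : k.-tuple bool => v (idx w))) => //.
- move=> w; split; last exact: vE.
  apply/in_closed_ball; first by rewrite mulr_gt0.
  by apply: le_trans (spread _ _ _ (below w0) (below w)) _; rewrite ler_pM2l.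
have sep (w z : k.-tuple bool) : tree_prec nu (idx w) (idx z) ->
    2 * e < `|v (idx w) - v (idx z)|.
  move=> /vlt h; rewrite distrC; apply: lt_le_trans (ler_norm _).
  have h1 : 3 * e <= b (idx z).
    rewrite (_ : 3 * e = a * q ^+ k / tau) ?ler_pdivrMr //; first by rewrite [leRHS]mulrC.
    by rewrite /e; field; rewrite gt_eqF.
  move: h; rewrite -/v => h; lra.
move=> w z wz.
have : idx w != idx z.
  apply: contra wz => /eqP /(comb_index_inj lev_ge) /eqP.
  by rewrite /leaf eqseq_cat // eqxx.
by case/(tree_prec_total nu)/orP => /sep //; rewrite distrC.
Qed.

End Intermediate.

(** * Attaining every dimension *)

(** A size that is at most A N lies between two consecutive levels from N on, and so, by
    doubling, is comparable to one of them. *)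
Lemma exists_level (R : realType) (A : nat -> R) (tau x : R) (N : nat) :
  (forall n, 0 < A n) -> 1 <= tau -> 0 < x -> x <= A N ->
  (forall n, A n <= tau * A n.+1) ->
  (forall e, 0 < e -> exists n0, forall n, (n0 <= n)%N -> A n < e) ->
  exists n, [/\ (N <= n)%N, A n <= x & x <= tau * A n].
Proof.
move=> A0 t1 x0 xN dbl small; have [n0 hn0] := small _ x0.
have : exists n, (N <= n)%N && (A n <= x).
  by exists (maxn N n0); rewrite leq_maxl ltW // hn0 // leq_maxr.
case/ex_minnP => n /andP[Nn nx] nmin; exists n; split => //.
have [e|ne] := eqVneq n N.
  by rewrite e; apply: le_trans xN _; rewrite ler_peMl // ltW.
have n_gt : (N < n)%N by rewrite ltn_neqAle eq_sym ne.
have n_pred : (N <= n.-1)%N by rewrite -ltnS prednK // (leq_ltn_trans _ n_gt).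
rewrite -(ltn_predK n_gt); apply: le_trans (dbl _); rewrite leNgt; apply/negP => h.
have := nmin n.-1; rewrite n_pred ltW // => /(_ isT).
by rewrite leqNgt ltn_predL (leq_ltn_trans _ n_gt).
Qed.

(** In their natural order, the gaps of one level follow each other, and their ends form
    arithmetic progressions of unbounded length. *)
Lemma natural_order_dim_ge1 (R : realType) (r : nat -> R) :
  (forall j, (1 <= j)%N -> 0 < r j < 1 / 2) ->
  (1%:E <= assouad_dim (arrangement (fun i => gap_seq r i.+1) ltn))%E.
Proof.
move=> hr; set b := fun i => gap_seq r i.+1.
have b0 i : 0 < b i by exact: level_gap_gt0.
have bcv : cvgn (fun n => \sum_(i < n) b i) := gap_seq_cvg hr.
have tot i j : i != j -> (ltn i j || ltn j i) by rewrite neq_ltn.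
have tr : transitive ltn by exact: ltn_trans.
have irr i : ltn i i = false by exact: ltnn.
have vE := gap_right_arrangement b0 bcv irr tr tot.
set v := gap_right b ltn in vE.
have vS j : v j.+1 = v j + b j.+1.
  rewrite /v {1}/gap_right /gap_left; congr (_ + _).
  rewrite /gap_right -(sum_over1 b0 bcv j).
  apply: (@sum_overD _ _ b0 bcv) => i /=; first by rewrite ltnS leq_eqVlt orbC.
  by move=> ij /eqP e; rewrite e ltnn in ij.
apply: (@assouad_dim_ge _ _ 1 3) => // rho k rho0.
have p2 : (0 : R) < 2 ^+ k by rewrite exprn_gt0.
have [n0 hn0] : exists n0, forall n, (n0 <= n)%N -> level_gap r n < rho / 2 ^+ k.
  by apply: level_gap_lt; rewrite // divr_gt0.
set n := maxn n0 k; set a := level_gap r n; pose i0 := (2 ^ n).-1.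
have n2 : (0 < 2 ^ n)%N by rewrite expn_gt0.
have kn : (2 ^ k <= 2 ^ n)%N by rewrite leq_exp2l // leq_maxr.
have a0 : 0 < a by exact: level_gap_gt0.
have bE x : (x < 2 ^ k)%N -> b (i0 + x)%N = a.
  move=> xk; apply: gap_seq_level; rewrite expnS /i0; lia.
have vx x : (x < 2 ^ k)%N -> v (i0 + x)%N = v i0 + x%:R * a.
  elim: x => [|x IH] xk; first by rewrite addn0 mul0r addr0.
  by rewrite addnS vS IH ?(ltnW xk) // -addnS bE // -natr1; ring.
exists k, (2 ^+ k * a), (a / 3), (v i0); split => //.
- by lra.
- have : (1 : R) <= 2 ^+ k by rewrite exprn_ege1 // ler1n.
  by move=> h; nra.
- by rewrite mulrC -ltr_pdivlMr //; apply: hn0; rewrite leq_maxl.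
split.
- rewrite invr1 powRr1 ?(ltW p2) // le_eqVlt; apply/orP; left; apply/eqP.
  by field; rewrite gt_eqF.
- exact: vE.
have -> : (2 : R) ^+ k = #|'I_(2 ^ k)|%:R by rewrite card_ord natrX.
apply: (@separated_covering_number _ _ (fun x : 'I_(2 ^ k) => v (i0 + x)%N)).
- by lra.
- move=> x; split; last exact: vE.
  apply/in_closed_ball; rewrite ?card_ord; first by rewrite mulr_gt0 // ltr0n expn_gt0.
  rewrite vx // opprD addrA subrr add0r normrN.
  rewrite ger0_norm; last exact: mulr_ge0 (ler0n _ _) (ltW a0).
  by rewrite ler_pM2r // ler_nat ltnW.
have sep (y z : 'I_(2 ^ k)) : (y < z)%N ->
    2 * (a / 3) < `|v (i0 + y)%N - v (i0 + z)%N|.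
  move=> yz; rewrite distrC; apply: lt_le_trans (ler_norm _); rewrite !vx //.
  have : y%:R + 1 <= z%:R :> R by rewrite natr1 ler_nat.
  by move=> h; nra.
by move=> y z; rewrite -val_eqE neq_ltn => /orP[] /sep //; rewrite distrC.
Qed.

(** With dimension 0 the gaps would decay faster than any geometric sequence, against
    doubling. *)
Lemma central_cantor_dim_gt0 (R : realType) (r : nat -> R) :
  (forall j, (1 <= j)%N -> 0 < r j < 1 / 2) -> doubling (gap_seq r) ->
  (0%:E < assouad_dim (central_cantor r))%E.
Proof.
move=> hr hdbl; rewrite ltNge; apply/negP => dim0.
have [tau t1 ht] := level_gap_doubling hr hdbl.
(* The ratio of 1 / N is 2^(-N), less than half of 1 / tau. *)
pose N := (Num.truncn (2 * tau)).+2.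
have NR : (2 : R) <= N%:R by rewrite ler_nat.
have N0 : (0 : R) < N%:R by rewrite ltr0n.
pose alpha : R := N%:R^-1.
have a0 : 0 < alpha by rewrite invr_gt0.
have a1 : alpha < 1 by rewrite invf_lt1 //; lra.
have dimlt : (assouad_dim (central_cantor r) < alpha%:E)%E.
  by apply: le_lt_trans dim0 _; rewrite lte_fin.
have [D D0 hD] := level_gap_decay hr hdbl a0 a1 dimlt.
set p := dim_ratio alpha in hD.
have p0 : 0 < p by exact: dim_ratio_gt0.
have pt : 2 * (tau * p) <= 1.
  have -> : p = (2 ^+ N)^-1 by rewrite /p /dim_ratio invrK powRN powR_mulrn.
  rewrite mulrA ler_pdivrMr ?exprn_gt0 // mul1r.
  apply: le_trans (ltW (truncnS_gt _)) _; rewrite -natrX ler_nat.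
  by apply: leq_trans (ltnW (ltn_expl _ (ltnSn 1))); exact: leqnSn.
have A0 := level_gap_gt0 hr.
have tA m : level_gap r 0 <= tau ^+ m * level_gap r m.
  elim: m => [|m IH]; first by rewrite expr0 mul1r.
  apply: le_trans IH _; rewrite exprSr -mulrA ler_wpM2l ?exprn_ge0 //.
  by apply: le_trans t1.
have bound m : 2 ^+ m <= D.
  have h : level_gap r 0 <= tau ^+ m * (D * level_gap r 0 * p ^+ m).
    apply: le_trans (tA m) _; rewrite ler_wpM2l ?exprn_ge0 //; first by apply: le_trans t1.
    exact: hD 0%N m.
  have h2 : 1 <= D * (tau * p) ^+ m.
    rewrite -(ler_pM2r (A0 0%N)) mul1r; apply: le_trans h _.
    by rewrite exprMn le_eqVlt; apply/orP; left; apply/eqP; ring.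
  have h3 : 2 ^+ m * (tau * p) ^+ m <= 1.
    by rewrite -exprMn exprn_ile1 // !mulr_ge0 // ?(ltW p0) // (le_trans _ t1).
  apply: (@le_trans _ _ (2 ^+ m * (D * (tau * p) ^+ m))).
    by rewrite ler_peMr ?exprn_ge0.
  by rewrite mulrCA ler_piMr // ltW.
have := bound (Num.truncn D).+1; rewrite leNgt; apply/negP/negPn.
apply: lt_le_trans (truncnS_gt _) _; rewrite -natrX ler_nat.
exact: ltnW (ltn_expl _ (ltnSn 1)).
Qed.

Theorem theorem10 (R : realType) (r : nat -> R)
  (hr : forall j, (1 <= j)%N -> 0 < r j < 1 / 2)
  (hdbl : doubling (gap_seq r))
  (s : R)
  (hs : (assouad_dim (central_cantor r) <= s%:E)%E)
  (hs1 : s <= 1) :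
  exists E : set R, complementary_set (gap_seq r) E /\ assouad_dim E = s%:E.
Proof.
have b_gt0 i : 0 < gap_seq r i.+1 by exact: level_gap_gt0.
have b_cvg := gap_seq_cvg hr.
(* With s = 1 no exponent between s and 1 is left to sum the gaps of a subtree. *)
have := hs1; rewrite le_eqVlt => /orP[/eqP ->|s_lt1].
  exists (arrangement (fun i => gap_seq r i.+1) ltn); split.
    apply: complementary_arrangement => //; first exact: ltnn.
    - exact: ltn_trans.
    - by move=> i j; rewrite neq_ltn.
  by apply/le_anti/andP; split; [exact: assouad_dim_le1|exact: natural_order_dim_ge1].
have s_gt0 : 0 < s.
  by rewrite -lte_fin; apply: lt_le_trans hs; exact: central_cantor_dim_gt0.
have [tau tau_ge1 A_doubling] := level_gap_doubling hr hdbl.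
have A_gt0 := level_gap_gt0 hr.
have A_lt := level_gap_lt hr.
have A_anti n m (h : (n <= m)%N) := level_gap_anti hdbl h.
have A_decay alpha : s < alpha -> alpha < 1 -> exists2 D : R, 0 < D &
    forall n m, level_gap r (n + m) <= D * level_gap r n * dim_ratio alpha ^+ m.
  move=> sa a1; apply: level_gap_decay => //; first exact: lt_trans sa.
  by apply: le_lt_trans hs _; rewrite lte_fin.
have q0 : 0 < dim_ratio s by exact: dim_ratio_gt0.
have q1 : dim_ratio s <= 1 by have := dim_ratio_lt12 s_gt0 s_lt1; lra.
have /choice[lev hlev] : forall d, exists n,
    [/\ (4 * block_start d <= n)%N,
      level_gap r n <= level_gap r (4 * block_start d) * dim_ratio s ^+ (d.+1 - block_start d)
    & level_gap r (4 * block_start d) * dim_ratio s ^+ (d.+1 - block_start d)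
      <= tau * level_gap r n].
  move=> d; apply: exists_level => //; first by rewrite mulr_gt0 ?exprn_gt0.
  by rewrite ler_piMr ?exprn_ile1 // ltW.
have lev_ge d : (4 * block_start d <= lev d)%N by case: (hlev d).
have lev_le d : level_gap r (lev d) <=
    level_gap r (4 * block_start d) * dim_ratio s ^+ (d.+1 - block_start d).
  by case: (hlev d).
have lev_lb d : level_gap r (4 * block_start d) * dim_ratio s ^+ (d.+1 - block_start d)
    <= tau * level_gap r (lev d).
  by case: (hlev d).
exists (arrangement (fun i => gap_seq r i.+1) (tree_prec (placement lev))); split.
  apply: complementary_arrangement => //.
  - exact: tree_precxx.
  - exact: tree_prec_trans.
  - exact: tree_prec_total.
apply/le_anti/andP; split.
  exact: (intermediate_dim_le (A := level_gap r) (tau := tau)).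
exact: (intermediate_dim_ge (A := level_gap r) (tau := tau)).
Qed.
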